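(* Let $M$ be a $kQ$-module and $P$ a projective $k\widetilde Q$-module, and let $I=\nu(P)$, where $\nu=D\mathrm{Hom}_{k\widetilde Q}(-,k\widetilde Q)$ is the Nakayama functor (so $I$ is injective with $\mathrm{soc}\,I=P/\mathrm{rad}P$). Suppose $[P,M]=[M,I]=1$. Fix nonzero morphisms $f\in\mathrm{Hom}_{k\widetilde Q}(P,M)$ and $g\in\mathrm{Hom}_{k\widetilde Q}(M,I)$, and consider the induced exact sequences $$0\to P'\to P\xrightarrow{f}M\to A\to0,\qquad 0\to B\to M\xrightarrow{g}I\to I'\to0.$$ Put $E=B\oplus I'[-1]$ and $E'=A\oplus P'[1]$. Assume that $[B,I']=[P',A]=0$. Then $$X_{\tau P}X_M=q^{\frac12\Lambda(\underline{\dim}P/\mathrm{rad}P,\,-(\widetilde I-\widetilde R)\underline m)}X_E+q^{\frac12\Lambda(\underline{\dim}P/\mathrm{rad}P,\,-(\widetilde I-\widetilde R)\underline m)-\frac12}X_{E'}.$$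
   Context: Setting. $k$ is a finite field, $q=|k|$, $m\ge n$ are positive integers, $\widetilde Q$ is an acyclic quiver with vertex set $\{1,\dots,m\}$ (vertices $n+1,\dots,m$ are frozen), and $Q$ is its full subquiver on $\{1,\dots,n\}$. All modules are finite-dimensional, $kQ$-modules are regarded as $k\widetilde Q$-modules, $S_i$ is the simple module at $i$; the module convention is that $\dim_k\mathrm{Ext}^1_{k\widetilde Q}(S_i,S_j)$ is the number of arrows $j\to i$. Notation: $[X,Y]=\dim_k\mathrm{Hom}_{k\widetilde Q}(X,Y)$. Matrices (all $m\times n$): $\widetilde B=(b_{ij})$ with $b_{ij}=|\{\text{arrows } i\to j\}|-|\{\text{arrows } j\to i\}|$; $\widetilde R=(\widetilde r_{ij})$ with $\widetilde r_{ij}=\dim_k\mathrm{Ext}^1_{k\widetilde Q}(S_i,S_j)$; $\widetilde I=\begin{bmatrix}I_n\\0\end{bmatrix}$. Assume given a skew-symmetric integer $m\times m$ matrix $\Lambda$ with $\Lambda(-\widetilde B)=\widetilde I$, and write $\Lambda(x,y)=x^{tr}\Lambda y$ for $x,y\in\mathbb Z^m$. Quantum torus: $\mathcal T$ is the $\mathbb Z[q^{\pm1/2}]$-algebra (with $q=|k|$) with basis $\{X^e: e\in\mathbb Z^m\}$ and product $X^eX^f=q^{\Lambda(e,f)/2}X^{e+f}$. The Euler form is $\langle M,N\rangle=\dim_k\mathrm{Hom}_{k\widetilde Q}(M,N)-\dim_k\mathrm{Ext}^1_{k\widetilde Q}(M,N)$; it depends only on dimension vectors. Underlined small letters denote dimension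 vectors ($\underline m=\underline{\dim}M$), regarded as columns in $\mathbb Z^n$ for $kQ$-modules; $\underline{\dim}P/\mathrm{rad}P$ is a vector in $\mathbb Z^m$. Quantum Caldero–Chapoton map: for a $kQ$-module $M$ and a projective $k\widetilde Q$-module $P$ (with $P[1]$ its shift), $$X_{M\oplus P[1]}=\sum_{\underline e}|\mathrm{Gr}_{\underline e}M|\,q^{-\frac12\langle\underline e,\underline m-\underline e\rangle}X^{\widetilde B\underline e-(\widetilde I-\widetilde R)\underline m+\underline{\dim}P/\mathrm{rad}P}\in\mathcal T,$$ where $\mathrm{Gr}_{\underline e}M$ is the set of submodules of $M$ of dimension vector $\underline e$. In the cluster category $\tau P=P[1]$, so $X_{\tau P}=X_{P[1]}=X^{\underline{\dim}P/\mathrm{rad}P}$. For an injective $k\widetilde Q$-module $J$, $J[-1]$ is identified with $P_J[1]$ where $P_J$ is the projective module with $P_J/\mathrm{rad}P_J\cong\mathrm{soc}\,J$; thus $X_{M\oplus J[-1]}:=X_{M\oplus P_J[1]}$. Since $k\widetilde Q$ is hereditary, $P'$ is projective and $I'$ is injective, so $X_E$ and $X_{E'}$ are defined. *)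

(* Defs.v *)
From HB Require Import structures.
From mathcomp Require Import all_boot all_order all_algebra all_field.
From mathcomp Require Import boolp.
From mathcomp Require Import finmap monalg ring.

Set Implicit Arguments.
Unset Strict Implicit.
Unset Printing Implicit Defensive.

Import Order.TTheory GRing.Theory Num.Theory.
Local Open Scope ring_scope.

Section CoefficientRing.
Variable k : finFieldType.

Definition sqrtq : algC := sqrtC #|k|%:R.

Lemma sqrtq_neq0 : sqrtq != 0.
Proof. by rewrite sqrtC_eq0 pnatr_eq0 -lt0n; apply/card_gt0P; exists 0. Qed.

(* Z[q^(1/2), q^(-1/2)] for the number q = #|k|, as a subring of algC. *)
Definition zhalf_pred : {pred algC} := fun z =>
  `[< exists (p : {poly int}) (N : nat),
        z = (map_poly intr p).[sqrtq] / sqrtq ^+ N >].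

Fact zhalf_subring : subring_closed zhalf_pred.
Proof.
have s0 N := expf_neq0 N sqrtq_neq0.
split.
- by apply/asboolP; exists 1, 0%N; rewrite rmorph1 hornerC expr0 divr1.
- move=> x y /asboolP[p [N ->]] /asboolP[r [L ->]]; apply/asboolP.
  exists (p * 'X^L - r * 'X^N), (N + L)%N.
  rewrite rmorphB !rmorphM /= !map_polyXn hornerD hornerN !hornerM !hornerXn.
  by rewrite exprD -mulNr addf_div // mulNr.
- move=> x y /asboolP[p [N ->]] /asboolP[r [L ->]]; apply/asboolP.
  by exists (p * r), (N + L)%N; rewrite rmorphM hornerM exprD mulf_div.
Qed.

HB.instance Definition _ :=
  GRing.isSubringClosed.Build algC zhalf_pred zhalf_subring.

Record zhalf := Zhalf { zhalf_val : algC; _ : zhalf_val \in zhalf_pred }.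

HB.instance Definition _ := [isSub for zhalf_val].
HB.instance Definition _ := [Choice of zhalf by <:].
HB.instance Definition _ := [SubChoice_isSubComNzRing of zhalf by <:].

Fact qhalf_subproof (z : int) : sqrtq ^ z \in zhalf_pred.
Proof.
apply/asboolP; case: z => N.
  by exists 'X^N, 0%N; rewrite map_polyXn hornerXn expr0 divr1.
by exists 1, N.+1; rewrite rmorph1 hornerC NegzE -exprnN mul1r.
Qed.

(* qhalf z is q^(z/2). *)
Definition qhalf (z : int) : zhalf := Zhalf (qhalf_subproof z).

Lemma qhalfD x y : qhalf (x + y) = qhalf x * qhalf y.
Proof. by apply: val_inj; rewrite rmorphM /= expfzDr ?sqrtq_neq0. Qed.

Lemma qhalf0 : qhalf 0 = 1.
Proof. by apply: val_inj; rewrite rmorph1 /= expr0z. Qed.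

Lemma qhalf2 : qhalf 2 = #|k|%:R.
Proof. by apply: val_inj; rewrite rmorph_nat; apply: sqrtCK. Qed.

End CoefficientRing.

Section TwistedProduct.
Variables (R : comNzRingType) (V : lmodType R) (T : zmodType) (X : T -> V).
Variables (w : T -> T -> R) (mul : V -> V -> V).
Hypothesis X_ind : forall P : V -> Prop, (forall c e, P (c *: X e)) ->
  (forall x y, P x -> P y -> P (x + y)) -> forall x, P x.
Hypotheses (mulDl : left_distributive mul +%R) (mulDr : right_distributive mul +%R).
Hypothesis mulX : forall c d e f,
  mul (c *: X e) (d *: X f) = (c * d * w e f) *: X (e + f).
Hypotheses (wDl : forall x y z, w (x + y) z = w x z * w y z)
  (wDr : forall x y z, w x (y + z) = w x y * w x z).
Hypotheses (w0l : forall x, w 0 x = 1) (w0r : forall x, w x 0 = 1).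

Fact twist_mulA : associative mul.
Proof.
move=> x y z; elim/X_ind: x => [c e|x1 x2 IH1 IH2]; last first.
  by rewrite !mulDl IH1 IH2.
elim/X_ind: y => [d f|x1 x2 IH1 IH2]; last first.
  by rewrite mulDl !mulDr mulDl IH1 IH2.
elim/X_ind: z => [b g|x1 x2 IH1 IH2]; last by rewrite !mulDr IH1 IH2.
by rewrite !mulX addrA wDl wDr; congr (_ *: _); ring.
Qed.

Fact twist_mul1l : left_id (X 0) mul.
Proof.
move=> x; elim/X_ind: x => [c e|x1 x2 IH1 IH2]; last by rewrite mulDr IH1 IH2.
by rewrite -[X 0]scale1r mulX mul1r add0r w0l mulr1.
Qed.

Fact twist_mul1r : right_id (X 0) mul.
Proof.
move=> x; elim/X_ind: x => [c e|x1 x2 IH1 IH2]; last by rewrite mulDl IH1 IH2.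
by rewrite -[X 0]scale1r mulX mulr1 addr0 w0r mulr1.
Qed.

Fact twist_scaleAl b x y : b *: mul x y = mul (b *: x) y.
Proof.
elim/X_ind: x => [c e|x1 x2 IH1 IH2]; last first.
  by rewrite mulDl !scalerDr mulDl IH1 IH2.
elim/X_ind: y => [d f|x1 x2 IH1 IH2]; last by rewrite !mulDr scalerDr IH1 IH2.
by rewrite scalerA !mulX scalerA !mulrA.
Qed.

Fact twist_scaleAr b x y : b *: mul x y = mul x (b *: y).
Proof.
elim/X_ind: x => [c e|x1 x2 IH1 IH2]; last first.
  by rewrite !mulDl scalerDr IH1 IH2.
elim/X_ind: y => [d f|x1 x2 IH1 IH2]; last first.
  by rewrite mulDr !scalerDr mulDr IH1 IH2.
by rewrite scalerA !mulX scalerA !mulrA [b * _]mulrC.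
Qed.

Fact twist_mulXX e f : mul (X e) (X f) = w e f *: X (e + f).
Proof. by rewrite -[X e]scale1r -[X f]scale1r mulX !mul1r. Qed.
End TwistedProduct.

(* The parameter L only selects the twisted product X^e X^f = q^(L(e,f)/2) X^(e+f)
   put on finitely supported functions (see qXM). *)
Definition qtorus (k : finFieldType) m (L : 'M[int]_m) : Type :=
  {malg (zhalf k)['cV[int]_m]}.
HB.instance Definition _ (k : finFieldType) m (L : 'M[int]_m) :=
  GRing.Lmodule.on (qtorus k L).

Section QuantumTorus.
Variables (k : finFieldType) (m : nat) (L : 'M[int]_m).
Local Notation qtorus := (qtorus k L).

Definition lam (x y : 'cV[int]_m) : int := (x^T *m L *m y) 0 0.

Lemma lamDl x y z : lam (x + y) z = lam x z + lam y z.
Proof. by rewrite /lam linearD /= !mulmxDl mxE. Qed.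

Lemma lamDr x y z : lam x (y + z) = lam x y + lam x z.
Proof. by rewrite /lam mulmxDr mxE. Qed.

Definition qX (e : 'cV[int]_m) : qtorus := mkmalgU e 1.

Fact qtmul_key : unit. Proof. exact: tt. Qed.
Definition qtmul : qtorus -> qtorus -> qtorus :=
  locked_with qtmul_key (fun x y =>
    \sum_(e <- msupp x) \sum_(f <- msupp y)
      (mcoeff e x * mcoeff f y * qhalf k (lam e f)) *: qX (e + f)).

Let qtmulw (d1 d2 : {fset 'cV[int]_m}) (x y : qtorus) :
  (msupp x `<=` d1)%fset -> (msupp y `<=` d2)%fset ->
  qtmul x y = \sum_(e <- d1) \sum_(f <- d2)
    (mcoeff e x * mcoeff f y * qhalf k (lam e f)) *: qX (e + f).
Proof.
move=> le_d1 le_d2; rewrite /qtmul unlock (big_fset_incl _ le_d1) /=.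
  apply/eq_bigr=> k1 _; apply/big_fset_incl => // f _ /mcoeff_outdom ->.
  by rewrite mulr0 mul0r scale0r.
move=> e _ /mcoeff_outdom e0.
by rewrite big1 // => f _; rewrite e0 !mul0r scale0r.
Qed.

Let qtmulDl : left_distributive qtmul +%R.
Proof.
move=> x y z; pose d := (msupp x `|` msupp y)%fset.
rewrite (@qtmulw d (msupp z) (x + y)) ?msuppD_le //.
rewrite (@qtmulw d (msupp z) x) ?fsubsetUl // (@qtmulw d (msupp z) y) ?fsubsetUr //.
rewrite -big_split; apply/eq_bigr=> e _; rewrite -big_split; apply/eq_bigr=> f _.
by rewrite mcoeffD !mulrDl scalerDl.
Qed.

Let qtmulDr : right_distributive qtmul +%R.
Proof.
move=> z x y; pose d := (msupp x `|` msupp y)%fset.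
rewrite (@qtmulw (msupp z) d _ (x + y)) ?msuppD_le //.
rewrite (@qtmulw (msupp z) d _ x) ?fsubsetUl // (@qtmulw (msupp z) d _ y) ?fsubsetUr //.
rewrite -big_split; apply/eq_bigr=> e _; rewrite -big_split; apply/eq_bigr=> f _.
by rewrite mcoeffD mulrDr mulrDl scalerDl.
Qed.

Let qt_scale c (e : 'cV[int]_m) : c *: qX e = mkmalgU e c.
Proof.
apply/malgP => f; rewrite [LHS]mcoeffZ [RHS]mcoeffU.
by rewrite [X in _ * X]mcoeffU mulrnAr mulr1.
Qed.

Let qtmulUU c d e f :
  qtmul (c *: qX e) (d *: qX f) = (c * d * qhalf k (lam e f)) *: qX (e + f).
Proof.
rewrite !qt_scale (qtmulw (@msuppU_le _ _ _ _) (@msuppU_le _ _ _ _)).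
by rewrite !big_seq_fset1 !mcoeffUU qt_scale.
Qed.

Let qt_ind (P : qtorus -> Prop) :
  (forall c e, P (c *: qX e)) -> (forall x y, P x -> P y -> P (x + y)) ->
  forall x, P x.
Proof.
move=> PX PD x; rewrite [x]monalgE; apply: big_ind => [|//|e _].
  by rewrite -(scale0r (qX 0)).
by rewrite -qt_scale.
Qed.

Fact qt1_neq0 : qX 0 != 0.
Proof.
apply/eqP => /(congr1 (mcoeff 0)); rewrite mcoeffUU mcoeff0 => /eqP.
by rewrite oner_eq0.
Qed.

Let w (e f : 'cV[int]_m) := qhalf k (lam e f).
Let wDl x y z : w (x + y) z = w x z * w y z.
Proof. by rewrite /w lamDl qhalfD. Qed.
Let wDr x y z : w x (y + z) = w x y * w x z.
Proof. by rewrite /w lamDr qhalfD. Qed.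
Let w0l x : w 0 x = 1.
Proof. by rewrite /w /lam trmx0 !mul0mx mxE qhalf0. Qed.
Let w0r x : w x 0 = 1.
Proof. by rewrite /w /lam mulmx0 mxE qhalf0. Qed.

HB.instance Definition _ := GRing.Zmodule_isNzRing.Build qtorus
  (twist_mulA qt_ind qtmulDl qtmulDr qtmulUU wDl wDr)
  (twist_mul1l qt_ind qtmulDr qtmulUU w0l)
  (twist_mul1r qt_ind qtmulDl qtmulUU w0r) qtmulDl qtmulDr qt1_neq0.

HB.instance Definition _ := GRing.Lmodule_isLalgebra.Build (zhalf k) qtorus
  (twist_scaleAl qt_ind qtmulDl qtmulDr qtmulUU).
HB.instance Definition _ := GRing.Lalgebra_isAlgebra.Build (zhalf k) qtorus
  (twist_scaleAr qt_ind qtmulDl qtmulDr qtmulUU).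

Lemma qXM e f : qX e * qX f = qhalf k (lam e f) *: qX (e + f).
Proof. exact: (twist_mulXX qtmulUU). Qed.

End QuantumTorus.

Arguments qX k {m} L e.

Record quiver (m : nat) := Quiver {
  arr : finType;
  src : arr -> 'I_m;
  tgt : arr -> 'I_m }.

Definition acyclic_quiver m (Q : quiver m) : Prop :=
  let e := [rel i j | [exists a : arr Q, (src a == i) && (tgt a == j)]] in
  forall i j, e i j -> ~~ connect e j i.

Section FullSubquiver.
Variables (n m : nat) (Q : quiver m).

Definition sub_arr := {a : arr Q | (src a < n)%N && (tgt a < n)%N}.

Definition full_sub : quiver n := @Quiver n sub_arr
  (fun a => Ordinal (proj1 (andP (valP a))))
  (fun a => Ordinal (proj2 (andP (valP a)))).
End FullSubquiver.

Section Modules.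
Variable k : fieldType.

(* A finite-dimensional left module over the path algebra kQ, given by the
   action of the vertex idempotents and of the arrows.  Paths are composed from
   left to right, so an arrow a : i -> j satisfies e_i a e_j = a and acts as a
   map e_j M -> e_i M.  With this convention dim Ext^1(S_i, S_j) is the number
   of arrows j -> i (ext1_dim_simple). *)
Record kmod m (Q : quiver m) := Kmod {
  carrier :> vectType k;
  idem : 'I_m -> 'End(carrier);
  act : arr Q -> 'End(carrier);
  idemM : forall i j, (idem i \o idem j)%VF = if i == j then idem i else 0;
  idem_sum : \sum_i idem i = \1%VF;
  act_idem : forall a, (idem (src a) \o act a \o idem (tgt a))%VF = act a }.

Section Homs.
Variables (m : nat) (Q : quiver m) (M N : kmod Q).

Definition commutators (I : finType) (u : I -> 'End(M)) (v : I -> 'End(N))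
    (h : 'Hom(M, N)) : {ffun I -> 'Hom(M, N)} :=
  [ffun i => ((h \o u i) - (v i \o h))%VF].

Fact commutators_linear I u v : linear (@commutators I u v).
Proof.
move=> c f g; apply/ffunP => i; rewrite !ffunE comp_lfunDl comp_lfunDr.
by rewrite -comp_lfunZl -comp_lfunZr scalerBr opprD addrACA.
Qed.
HB.instance Definition _ I u v := GRing.isLinear.Build k _ _ _ _
  (@commutators_linear I u v).

Definition graded_homs : {vspace 'Hom(M, N)} :=
  lker (linfun (commutators (@idem _ _ M) (@idem _ _ N))).

Definition coboundary : 'Hom('Hom(M, N), {ffun arr Q -> 'Hom(M, N)}) :=
  linfun (commutators (@act _ _ M) (@act _ _ N)).

Definition homs : {vspace 'Hom(M, N)} := (graded_homs :&: lker coboundary)%VS.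

Lemma graded_homsP h :
  reflect (forall i, h \o idem M i = idem N i \o h)%VF (h \in graded_homs).
Proof.
rewrite memv_ker lfunE; apply: (iffP eqP) => [/ffunP H i|H].
  by apply/eqP; rewrite -subr_eq0; have := H i; rewrite !ffunE => ->.
by apply/ffunP => i; rewrite !ffunE H subrr.
Qed.

Lemma homsP h :
  reflect ((forall i, h \o idem M i = idem N i \o h)%VF /\
           (forall a, h \o act M a = act N a \o h)%VF) (h \in homs).
Proof.
rewrite memv_cap memv_ker lfunE.
apply: (iffP andP) => [[/graded_homsP Hi /eqP/ffunP H]|[Hi H]]; split=> //.
- by move=> a; apply/eqP; rewrite -subr_eq0; have := H a; rewrite !ffunE => ->.
- exact/graded_homsP.
- by apply/eqP/ffunP => i; rewrite !ffunE H subrr.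
Qed.

Definition hom_dim : nat := \dim homs.

Definition arrow_block (xi : {ffun arr Q -> 'Hom(M, N)}) :
    {ffun arr Q -> 'Hom(M, N)} :=
  [ffun a => (idem N (src a) \o xi a \o idem M (tgt a))%VF].

Fact arrow_block_linear : linear arrow_block.
Proof.
move=> c f g; apply/ffunP => a; rewrite !ffunE comp_lfunDr comp_lfunDl.
by rewrite -comp_lfunZr -comp_lfunZl.
Qed.
HB.instance Definition _ := GRing.isLinear.Build k _ _ _ _ arrow_block_linear.

(* Ext^1(M, N): a family (xi_a : e_(tgt a) M -> e_(src a) N)_a is the
   off-diagonal block of a module structure on N + M extending M by N; two
   families give equivalent extensions iff they differ by the coboundary of a
   graded map M -> N. *)
Definition cocycles : {vspace {ffun arr Q -> 'Hom(M, N)}} := limg (linfun arrow_block).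

Definition ext1_dim : nat := (\dim cocycles - \dim (coboundary @: graded_homs))%N.

Definition euler : int := hom_dim%:Z - ext1_dim%:Z.

End Homs.

Section PathAlgebra.
Variables (m : nat) (Q : quiver m).

Fixpoint composable (x : 'I_m) (s : seq (arr Q)) : bool :=
  if s is a :: s' then (src a == x) && composable (tgt a) s' else true.

(* In an acyclic quiver on m vertices every path has fewer than m arrows, so
   the bound m on lengths loses nothing. *)
Definition qpath := {p : 'I_m * m.-bseq (arr Q) | composable p.1 p.2}.

Definition pstart (p : qpath) : 'I_m := (val p).1.
Definition parrows (p : qpath) : seq (arr Q) := (val p).2.
Definition pend (p : qpath) : 'I_m := last (pstart p) (map (@tgt _ Q) (parrows p)).

Definition is_concat (p1 p2 p : qpath) : bool :=
  [&& pstart p1 == pstart p, pend p1 == pstart p2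
    & parrows p1 ++ parrows p2 == parrows p].

Definition pathalg := {ffun qpath -> k^o}.

(* (x y)(p) is the sum of x(p1) y(p2) over all factorisations p = p1 p2. *)
Definition pmul (x y : pathalg) : pathalg :=
  [ffun p => \sum_(r : qpath * qpath | is_concat r.1 r.2 p) x r.1 * y r.2].

Definition pvertex (i : 'I_m) : pathalg :=
  [ffun p => ((pstart p == i) && (parrows p == [::]))%:R].
Definition parrow (a : arr Q) : pathalg := [ffun p => (parrows p == [:: a])%:R].

Lemma qpath_inj (p r : qpath) : pstart p = pstart r -> parrows p = parrows r -> p = r.
Proof.
case: p r => [[x s] xs] [[y t] yt]; rewrite /pstart /parrows /= => e1 e2.
by apply: val_inj => /=; rewrite e1; congr pair; apply: val_inj.
Qed.

Lemma composable_cat x s t :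
  composable x (s ++ t) = composable x s && composable (last x (map (@tgt _ Q) s)) t.
Proof. by elim: s x => //= a s IHs x; rewrite IHs andbA. Qed.

Lemma pcomposable p : composable (pstart p) (parrows p).
Proof. exact: (valP p). Qed.

Lemma psize p : (size (parrows p) <= m)%N.
Proof. exact: size_bseq. Qed.

Definition mkpath x s (hs : (size s <= m)%N) (xs : composable x s) : qpath :=
  exist _ (x, Bseq hs) xs.

Lemma pmulDl : left_distributive pmul +%R.
Proof.
move=> x y z; apply/ffunP => p; rewrite !ffunE -big_split /=.
by apply: eq_bigr => r _; rewrite ffunE mulrDl.
Qed.

Lemma pmulDr : right_distributive pmul +%R.
Proof.
move=> x y z; apply/ffunP => p; rewrite !ffunE -big_split /=.
by apply: eq_bigr => r _; rewrite ffunE mulrDr.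
Qed.

Lemma pmulZl c x y : pmul (c *: x) y = c *: pmul x y.
Proof.
apply/ffunP => p; rewrite !ffunE scaler_sumr.
by apply: eq_bigr => r _; rewrite ffunE -mulrA.
Qed.

Lemma pmulZr c x y : pmul x (c *: y) = c *: pmul x y.
Proof.
apply/ffunP => p; rewrite !ffunE scaler_sumr.
by apply: eq_bigr => r _; rewrite ffunE mulrCA.
Qed.

Fact pmul_linear x : linear (pmul x).
Proof. by move=> c y z; rewrite pmulDr pmulZr. Qed.
HB.instance Definition _ x := GRing.isLinear.Build k _ _ _ _ (pmul_linear x).

Fact pmulr_linear y : linear (pmul^~ y).
Proof. by move=> c x z; rewrite pmulDl pmulZl. Qed.

Definition lmul (x : pathalg) : 'End(pathalg) := linfun (pmul x).
Definition rmul_fun (y x : pathalg) : pathalg := pmul x y.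
HB.instance Definition _ y := GRing.isLinear.Build k _ _ _ (rmul_fun y) (pmulr_linear y).
Definition rmul (y : pathalg) : 'End(pathalg) := linfun (rmul_fun y).

Let is_concat3 (p1 p2 p3 p : qpath) :=
  [&& pstart p1 == pstart p, pend p1 == pstart p2, pend p2 == pstart p3
    & parrows p1 ++ parrows p2 ++ parrows p3 == parrows p].

Let pend_concat p1 p2 p : is_concat p1 p2 p -> pend p = pend p2.
Proof.
case/and3P=> /eqP e1 /eqP e2 /eqP e3.
by rewrite /pend -e3 map_cat last_cat -e1 -/(pend p1) e2.
Qed.

Let concatl p1 p2 p3 p (F : k^o) :
  \sum_(r | is_concat p1 p2 r && is_concat r p3 p) F =
  if is_concat3 p1 p2 p3 p then F else 0.
Proof.
case: ifP => [/and4P[/eqP e1 /eqP e2 /eqP e3 /eqP e4] | c3]; last first.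
  apply: big1 => r /andP[c1 /and3P[/eqP d1 /eqP d2 /eqP d3]].
  have /and3P[/eqP f1 /eqP f2 /eqP f3] := c1; case/negP: c3; apply/and4P.
  by rewrite f1 d1 f2 -(pend_concat c1) d2 catA f3 d3 !eqxx.
have sz : (size (parrows p1 ++ parrows p2) <= m)%N.
  by apply: leq_trans (psize p); rewrite -e4 catA [in leqRHS]size_cat leq_addr.
have cp : composable (pstart p) (parrows p1 ++ parrows p2).
  by rewrite composable_cat -e1 pcomposable -/(pend p1) e2 pcomposable.
rewrite (bigD1 (mkpath sz cp)) /=; last first.
  have E : is_concat p1 p2 (mkpath sz cp) by apply/and3P; rewrite e1 e2; split.
  rewrite E /=; apply/and3P; split=> //; first by rewrite (pend_concat E) e3.
  by rewrite -e4 catA.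
rewrite big1 ?addr0 // => r /andP[/andP[/and3P[/eqP d1 _ /eqP d3] _]] /eqP[].
by apply: qpath_inj; [rewrite -d1 e1 | rewrite -d3].
Qed.

Let concatr p1 p2 p3 p (F : k^o) :
  \sum_(r | is_concat p2 p3 r && is_concat p1 r p) F =
  if is_concat3 p1 p2 p3 p then F else 0.
Proof.
case: ifP => [/and4P[/eqP e1 /eqP e2 /eqP e3 /eqP e4] | c3]; last first.
  apply: big1 => r /andP[/and3P[/eqP f1 /eqP f2 /eqP f3] /and3P[/eqP d1 /eqP d2 /eqP d3]].
  by case/negP: c3; apply/and4P; rewrite d1 d2 f1 f2 f3 d3 !eqxx.
have sz : (size (parrows p2 ++ parrows p3) <= m)%N.
  by apply: leq_trans (psize p); rewrite -e4 [in leqRHS]size_cat leq_addl.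
have cp : composable (pstart p2) (parrows p2 ++ parrows p3).
  by rewrite composable_cat pcomposable -/(pend p2) e3 pcomposable.
rewrite (bigD1 (mkpath sz cp)) /=; last first.
  by apply/andP; split; apply/and3P; split=> //; apply/eqP.
rewrite big1 ?addr0 // => r /andP[/andP[/and3P[/eqP d1 _ /eqP d3] _]] /eqP[].
by apply: qpath_inj; [rewrite -d1 | rewrite -d3].
Qed.

Lemma pmulA : associative pmul.
Proof.
move=> x y z; apply/ffunP => p.
pose T := \sum_(p1 : qpath) \sum_(p2 : qpath) \sum_(p3 : qpath)
  (if is_concat3 p1 p2 p3 p then x p1 * y p2 * z p3 else 0).
transitivity T; last symmetry; rewrite ffunE.
- rewrite -(pair_big_dep xpredT (fun p1 r => is_concat p1 r p)
    (fun p1 r => x p1 * pmul y z r)) /=; apply: eq_bigr => p1 _.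
  transitivity (\sum_(r | is_concat p1 r p) \sum_(p2 : qpath)
      \sum_(p3 | is_concat p2 p3 r) x p1 * y p2 * z p3).
    apply: eq_bigr => r _; rewrite ffunE mulr_sumr.
    rewrite -(pair_big_dep xpredT (fun p2 p3 => is_concat p2 p3 r)
      (fun p2 p3 => x p1 * (y p2 * z p3))) /=.
    by apply: eq_bigr => p2 _; apply: eq_bigr => p3 _; rewrite mulrA.
  rewrite exchange_big; apply: eq_bigr => p2 _.
  rewrite (exchange_big_dep xpredT) //=; apply: eq_bigr => p3 _.
  by rewrite -concatr; apply: eq_bigl => r; rewrite andbC.
- transitivity (\sum_(r : qpath) \sum_(p3 | is_concat r p3 p)
     \sum_(p1 : qpath) \sum_(p2 | is_concat p1 p2 r) x p1 * y p2 * z p3).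
    rewrite -(pair_big_dep xpredT (fun r p3 => is_concat r p3 p)
      (fun r p3 => pmul x y r * z p3)) /=.
    apply: eq_bigr => r _; apply: eq_bigr => p3 _; rewrite ffunE mulr_suml.
    by rewrite -(pair_big_dep xpredT (fun p1 p2 => is_concat p1 p2 r)
      (fun p1 p2 => x p1 * y p2 * z p3)).
  pose G (r p3 p1 p2 : qpath) : k^o :=
    if is_concat p1 p2 r && is_concat r p3 p then x p1 * y p2 * z p3 else 0.
  transitivity (\sum_r \sum_p3 \sum_p1 \sum_p2 G r p3 p1 p2).
    apply: eq_bigr => r _; rewrite big_mkcond; apply: eq_bigr => p3 _ /=.
    case: ifP => c; last by rewrite big1 // => p1 _; rewrite big1 // => p2 _; rewrite /G c andbF.
    apply: eq_bigr => p1 _; rewrite big_mkcond; apply: eq_bigr => p2 _.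
    by rewrite /G c andbT.
  transitivity (\sum_p3 \sum_p1 \sum_p2 \sum_r G r p3 p1 p2).
    rewrite exchange_big; apply: eq_bigr => p3 _.
    by rewrite exchange_big; apply: eq_bigr => p1 _; rewrite exchange_big.
  rewrite exchange_big; apply: eq_bigr => p1 _.
  rewrite exchange_big; apply: eq_bigr => p2 _; apply: eq_bigr => p3 _.
  by rewrite -concatl [RHS]big_mkcond.
Qed.

Lemma pvertex_mul i x : pmul (pvertex i) x = [ffun p => if pstart p == i then x p else 0].
Proof.
apply/ffunP => p; rewrite !ffunE; case: eqP => [<-|ne]; last first.
  apply: big1 => -[p1 p2] /= /and3P[/eqP e1 _ _]; rewrite ffunE e1.
  by case: eqP => [/ne//|_]; rewrite mul0r.
have H0 : (size ([::] : seq (arr Q)) <= m)%N by [].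
pose p0 := @mkpath (pstart p) [::] H0 isT.
rewrite (bigD1 (p0, p)) /=; last by apply/and3P; split=> //=; apply/eqP.
rewrite ffunE !eqxx mul1r big1 ?addr0 // => -[p1 p2] /= /andP[/and3P[/eqP e1 /eqP e2 /eqP e3]].
rewrite ffunE; case: (altP (parrows p1 =P [::])) => [n1|_]; last by rewrite andbF mul0r.
case/eqP; congr pair; first exact: qpath_inj.
by apply: qpath_inj; [rewrite -e1 -e2 /pend n1 | rewrite -e3 n1].
Qed.

Lemma mul_pvertex i x : pmul x (pvertex i) = [ffun p => if pend p == i then x p else 0].
Proof.
apply/ffunP => p; rewrite !ffunE; case: eqP => [<-|ne]; last first.
  apply: big1 => -[p1 p2] /= c; have /and3P[_ /eqP e2 _] := c; rewrite ffunE.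
  case: (altP (parrows p2 =P [::])) => [n2|_]; last by rewrite andbF [X in _ * X]/= mulr0.
  case: eqP => [s2|_]; last by rewrite /= mulr0.
  by case: ne; rewrite -s2 (pend_concat c) /pend n2.
have H0 : (size ([::] : seq (arr Q)) <= m)%N by [].
pose p0 := @mkpath (pend p) [::] H0 isT.
rewrite (bigD1 (p, p0)) /=; last by apply/and3P; split; rewrite ?cats0.
rewrite ffunE !eqxx mulr1 big1 ?addr0 // => -[p1 p2] /= /andP[/and3P[/eqP e1 /eqP e2 /eqP e3]].
rewrite ffunE; case: (altP (parrows p2 =P [::])) => [n2|_]; last by rewrite andbF [X in _ * X]/= mulr0.
move: e3; rewrite n2 cats0 => e3.
have -> : p1 = p by apply: qpath_inj.
case: (pstart p2 =P pend p) => [s2|_]; last by rewrite /= mulr0.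
by case/eqP; congr pair; apply: qpath_inj.
Qed.

Lemma pvertexM i j : pmul (pvertex i) (pvertex j) = if i == j then pvertex i else 0.
Proof.
rewrite pvertex_mul; apply/ffunP => p; rewrite !ffunE.
case: (eqVneq i j) => [<-|ne]; rewrite !ffunE; first by case: eqP.
by case: (eqVneq (pstart p) i) => [->|//]; rewrite (negPf ne).
Qed.

Lemma pvertex_sum x : \sum_i pmul (pvertex i) x = x.
Proof.
apply/ffunP => p; rewrite sum_ffunE (bigD1 (pstart p)) //= pvertex_mul ffunE eqxx.
by rewrite big1 ?addr0 // => i ne; rewrite pvertex_mul ffunE eq_sym (negPf ne).
Qed.

Lemma mul_pvertex_sum x : \sum_i pmul x (pvertex i) = x.
Proof.
apply/ffunP => p; rewrite sum_ffunE (bigD1 (pend p)) //= mul_pvertex ffunE eqxx.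
by rewrite big1 ?addr0 // => i ne; rewrite mul_pvertex ffunE eq_sym (negPf ne).
Qed.

Lemma pvertex_arrow a : pmul (pvertex (src a)) (parrow a) = parrow a.
Proof.
rewrite pvertex_mul; apply/ffunP => p; rewrite !ffunE.
case: eqP => // ne; case: eqP => // e; have := pcomposable p; rewrite e /= andbT.
by move/eqP => s; case: ne.
Qed.

Lemma arrow_pvertex a : pmul (parrow a) (pvertex (tgt a)) = parrow a.
Proof.
rewrite mul_pvertex; apply/ffunP => p; rewrite !ffunE.
by case: eqP => // ne; case: eqP => // e; case: ne; rewrite /pend e.
Qed.

Fact regular_idemM i j :
  (lmul (pvertex i) \o lmul (pvertex j))%VF = if i == j then lmul (pvertex i) else 0.
Proof.
apply/lfunP => x; rewrite comp_lfunE !lfunE /= pmulA pvertexM.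
by case: eqP => _; rewrite !lfunE //=; apply/ffunP => p; rewrite !ffunE big1 // => r _; rewrite ffunE mul0r.
Qed.

Fact regular_idem_sum : \sum_i lmul (pvertex i) = \1%VF.
Proof.
apply/lfunP => x; rewrite sum_lfunE id_lfunE -[RHS]pvertex_sum.
by apply: eq_bigr => i _; rewrite lfunE.
Qed.

Fact regular_act_idem a :
  (lmul (pvertex (src a)) \o lmul (parrow a) \o lmul (pvertex (tgt a)))%VF = lmul (parrow a).
Proof.
apply/lfunP => x; rewrite !comp_lfunE !lfunE /=.
by rewrite !pmulA pvertex_arrow arrow_pvertex.
Qed.

Definition regular : kmod Q := Kmod regular_idemM regular_idem_sum regular_act_idem.

End PathAlgebra.

(* nu(P) = D Hom_kQ(P, kQ): Hom_kQ(P, kQ) is a right module through right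
   multiplication in kQ, and its k-dual is a left module. *)
Section Nakayama.
Variables (m : nat) (Q : quiver m) (P : kmod Q).

Let H := homs P (regular Q).

Definition right_act (y : pathalg Q) (h : subvs_of H) : subvs_of H :=
  vsproj H (rmul y \o vsval h)%VF.

Fact rmul_homs y h : h \in H -> (rmul y \o h)%VF \in H.
Proof.
have C x : (rmul y \o lmul x = lmul x \o rmul y)%VF.
  by apply/lfunP => z; rewrite !comp_lfunE !lfunE /= /rmul_fun pmulA.
case/homsP => Hi Ha; apply/homsP; split=> [i|a].
  by rewrite -comp_lfunA Hi !comp_lfunA; congr (_ \o _)%VF; exact: C.
by rewrite -comp_lfunA Ha !comp_lfunA; congr (_ \o _)%VF; exact: C.
Qed.

Lemma val_right_act y h : vsval (right_act y h) = (rmul y \o vsval h)%VF.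
Proof. by rewrite /right_act vsprojK // rmul_homs // subvsP. Qed.

Fact right_act_linear y : linear (right_act y).
Proof.
move=> c f g; apply: subvs_inj.
by rewrite linearP /= !val_right_act linearP comp_lfunDr comp_lfunZr.
Qed.
HB.instance Definition _ y := GRing.isLinear.Build k _ _ _ _ (right_act_linear y).

Definition dual_fun (y : pathalg Q) (xi : 'Hom(subvs_of H, k^o)) :
  'Hom(subvs_of H, k^o) := (xi \o linfun (right_act y))%VF.

Fact dual_fun_linear y : linear (dual_fun y).
Proof. by move=> c f g; rewrite /dual_fun comp_lfunDl -comp_lfunZl. Qed.
HB.instance Definition _ y := GRing.isLinear.Build k _ _ _ _ (dual_fun_linear y).

Definition dual_act (y : pathalg Q) : 'End('Hom(subvs_of H, k^o)) := linfun (dual_fun y).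

Lemma dual_actE y xi h : dual_act y xi h = xi (right_act y h).
Proof. by rewrite lfunE /= comp_lfunE lfunE. Qed.

Lemma right_actM y z h : right_act z (right_act y h) = right_act (pmul y z) h.
Proof.
apply: subvs_inj; rewrite !val_right_act comp_lfunA; congr (_ \o _)%VF.
by apply/lfunP => x; rewrite comp_lfunE !lfunE /= /rmul_fun pmulA.
Qed.

Fact nakayama_idemM i j :
  (dual_act (pvertex Q i) \o dual_act (pvertex Q j))%VF =
  if i == j then dual_act (pvertex Q i) else 0.
Proof.
apply/lfunP => xi; apply/lfunP => h.
rewrite comp_lfunE !dual_actE right_actM pvertexM.
case: (i == j); first by rewrite dual_actE.
rewrite !zero_lfunE (_ : right_act 0 h = 0) ?linear0 //.
apply: subvs_inj; rewrite val_right_act linear0; apply/lfunP => x.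
by rewrite comp_lfunE lfunE zero_lfunE /= /rmul_fun linear0.
Qed.

Fact nakayama_idem_sum : \sum_i dual_act (pvertex Q i) = \1%VF.
Proof.
apply/lfunP => xi; apply/lfunP => h; rewrite sum_lfunE sum_lfunE id_lfunE.
under eq_bigr do rewrite dual_actE.
rewrite -linear_sum; congr (xi _); apply: subvs_inj; rewrite linear_sum /=.
under eq_bigr do rewrite val_right_act.
apply/lfunP => x; rewrite sum_lfunE -[RHS]mul_pvertex_sum.
by apply: eq_bigr => i _; rewrite comp_lfunE lfunE.
Qed.

Fact nakayama_act_idem a :
  (dual_act (pvertex Q (src a)) \o dual_act (parrow a)
    \o dual_act (pvertex Q (tgt a)))%VF = dual_act (parrow a).
Proof.
apply/lfunP => xi; apply/lfunP => h.
by rewrite !comp_lfunE !dual_actE !right_actM pmulA pvertex_arrow arrow_pvertex.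
Qed.

Definition nakayama : kmod Q :=
  Kmod nakayama_idemM nakayama_idem_sum nakayama_act_idem.
End Nakayama.

Definition projective m (Q : quiver m) (P : kmod Q) : Prop :=
  forall (M N : kmod Q) (p : 'Hom(M, N)) (g : 'Hom(P, N)),
    p \in homs M N -> limg p = fullv -> g \in homs P N ->
  exists2 g' : 'Hom(P, M), g' \in homs P M & (p \o g')%VF = g.

Definition exact4 (U V W X : vectType k)
    (i : 'Hom(U, V)) (f : 'Hom(V, W)) (p : 'Hom(W, X)) : Prop :=
  [/\ lker i = 0%VS, limg i = lker f, limg f = lker p & limg p = fullv].

Section Simple.
Variables (m : nat) (Q : quiver m) (i : 'I_m).

Let simple_idem (j : 'I_m) : 'End(k^o) := if j == i then \1%VF else 0.
Let simple_act (a : arr Q) : 'End(k^o) := 0.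

Fact simple_idemM j l : (simple_idem j \o simple_idem l)%VF =
  if j == l then simple_idem j else 0.
Proof.
rewrite /simple_idem; case: (eqVneq j l) => [<-|ne].
  by case: eqP => _; rewrite ?comp_lfun1l ?comp_lfun0l.
case: (eqVneq j i) => [ji|_]; last by rewrite comp_lfun0l.
by rewrite -ji eq_sym (negPf ne) comp_lfun0r.
Qed.

Fact simple_idem_sum : \sum_j simple_idem j = \1%VF.
Proof.
rewrite (bigD1 i) //= big1 ?addr0 /simple_idem ?eqxx // => j ne.
by rewrite (negPf ne).
Qed.

Fact simple_act_idem a :
  (simple_idem (src a) \o simple_act a \o simple_idem (tgt a))%VF = simple_act a.
Proof. by rewrite /simple_act comp_lfun0r comp_lfun0l. Qed.

Definition simple_mod : kmod Q := Kmod simple_idemM simple_idem_sum simple_act_idem.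
End Simple.

Section ZeroModule.
Variables (m : nat) (Q : quiver m).
Let V : vectType k := 'rV[k]_0.

Fact zero_idemM (i j : 'I_m) :
  ((0 : 'End(V)) \o (0 : 'End(V)))%VF = if i == j then 0 else 0.
Proof. by rewrite comp_lfun0l; case: eqP. Qed.

Fact zero_idem_sum : \sum_(i < m) (0 : 'End(V)) = \1%VF.
Proof. by apply/lfunP => x; rewrite [x]thinmx0 !linear0. Qed.

Fact zero_act_idem (a : arr Q) :
  ((0 : 'End(V)) \o (0 : 'End(V)) \o (0 : 'End(V)))%VF = 0.
Proof. by rewrite comp_lfun0r. Qed.

Definition zero_mod : kmod Q :=
  @Kmod m Q V (fun=> 0) (fun=> 0) zero_idemM zero_idem_sum zero_act_idem.
End ZeroModule.

(* A module over the full subquiver on the first n vertices, extended by zero. *)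
Section Inflation.
Variables (n m : nat) (le_nm : (n <= m)%N) (Q : quiver m) (M : kmod (full_sub n Q)).

Definition infl_idem (i : 'I_m) : 'End(M) := oapp (@idem _ _ M) 0 (insub (i : nat)).
Definition infl_act (a : arr Q) : 'End(M) := oapp (@act _ _ M) 0 (insub a).

Fact infl_idemM i j : (infl_idem i \o infl_idem j)%VF = if i == j then infl_idem i else 0.
Proof.
rewrite /infl_idem; case: insubP => [u _ ui|_] /=; last by rewrite comp_lfun0l if_same.
case: insubP => [v _ vj|nj] /=.
  by rewrite idemM -!val_eqE ui vj.
rewrite comp_lfun0r; case: eqP => // ij.
by rewrite -ij -ui ltn_ord in nj.
Qed.

Fact infl_idem_sum : \sum_i infl_idem i = \1%VF.
Proof.
rewrite -(idem_sum M) /infl_idem; pose F j := oapp (@idem _ _ M) 0 (insub j).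
transitivity (\sum_(i < n) F i); last first.
  by apply: eq_bigr => i _; rewrite /F; case: insubP => [u _ /val_inj ->|]; rewrite ?ltn_ord.
rewrite (big_ord_widen m F le_nm) [RHS]big_mkcond; apply: eq_bigr => i _.
by case: ifP => // ni; rewrite insubN // ni.
Qed.

Fact infl_act_idem a :
  (infl_idem (src a) \o infl_act a \o infl_idem (tgt a))%VF = infl_act a.
Proof.
rewrite /infl_act; case: insubP => [u ua <-|_] /=; last by rewrite comp_lfun0r comp_lfun0l.
rewrite -[RHS]act_idem /infl_idem.
have E (j : 'I_n) (i : 'I_m) : val j = i :> nat -> insub (i : nat) = Some j.
  by move=> <-; rewrite valK.
by rewrite (E (@src _ (full_sub n Q) u)) ?(E (@tgt _ (full_sub n Q) u)).
Qed.

Definition inflate : kmod Q := Kmod infl_idemM infl_idem_sum infl_act_idem.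
End Inflation.

Lemma ext1_dim_simple m (Q : quiver m) i j :
  ext1_dim (simple_mod Q i) (simple_mod Q j) =
  #|[set a : arr Q | (src a == j) && (tgt a == i)]|.
Proof.
set M := simple_mod Q i; set N := simple_mod Q j.
rewrite /ext1_dim.
have -> : (coboundary M N @: graded_homs M N = 0)%VS.
  apply/eqP; rewrite -subv0; apply/subvP => _ /memv_imgP[h _ ->].
  rewrite memv0 lfunE; apply/eqP/ffunP => a.
  by rewrite !ffunE comp_lfun0r comp_lfun0l subrr.
rewrite dimv0 subn0; set D := [set a | _].
pose E a (c : arr Q) : 'Hom(M, N) := if c == a then \1%VF else 0.
pose b := [seq [ffun c => E a c] | a <- enum D].
have bE (xi : {ffun arr Q -> 'Hom(M, N)}) c :
    arrow_block xi c = if c \in D then xi c else 0.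
  rewrite ffunE /= inE; case: (src c == j); case: (tgt c == i);
    by rewrite /= ?comp_lfun0l ?comp_lfun0r ?comp_lfun1l ?comp_lfun1r.
have -> : cocycles M N = <<b>>%VS.
  apply: subv_anti; apply/andP; split; last first.
    apply/span_subvP => y /mapP[a]; rewrite mem_enum => aD ->{y}.
    rewrite -[[ffun _ => _]](_ : linfun (@arrow_block _ _ M N) [ffun c => E a c] = _).
      exact: memv_img (memvf _).
    rewrite lfunE; apply/ffunP => c; rewrite bE !ffunE /E.
    by case: eqP => [->|_]; rewrite ?aD ?if_same.
  apply/subvP => _ /memv_imgP[xi _ ->]; rewrite lfunE /=.
  have -> : arrow_block xi = \sum_(a <- enum D) (xi a 1 : k) *: [ffun c => E a c].
    apply/ffunP => c; rewrite bE sum_ffunE.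
    transitivity (\sum_(a in D) (xi a 1 : k) *: E a c); last first.
      by rewrite big_enum; apply: eq_bigr => a _; rewrite !ffunE.
    case: ifP => cD; last first.
      rewrite big1 // => a aD; rewrite /E; case: eqP => [ca|_]; last exact: scaler0.
      by rewrite ca aD in cD.
    rewrite (bigD1 c) //= big1 => [|a /andP[_ ne]]; last by rewrite /E eq_sym (negPf ne) scaler0.
    rewrite addr0 /E eqxx; apply/lfunP => x.
    rewrite scale_lfunE id_lfunE -{1}[x]mulr1.
    by rewrite [x * 1](_ : _ = x *: (1 : k^o)) // linearZ; apply: mulrC.
  rewrite big_seq; apply: rpred_sum => a aD; apply: rpredZ.
  by apply: memv_span; apply: map_f.
have sb : size b = #|D| by rewrite size_map cardE.
suff fb : free b by move: fb; rewrite /free => /eqP ->.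
apply/(freeP (X := in_tuple b)) => c c0 l.
have lD : (l < size (enum D))%N by rewrite -[X in (_ < X)%N](size_map (fun a => [ffun c => E a c])).
have [a0 _] : {a0 | a0 \in enum D}.
  by case: (enum D) lD => // a0 s _; exists a0; rewrite inE eqxx.
have := congr1 (fun xi : {ffun arr Q -> 'Hom(M, N)} => xi (nth a0 (enum D) l) 1) c0.
rewrite ffunE zero_lfunE sum_ffunE sum_lfunE (bigD1 l) //= big1 => [|l' ne].
  rewrite addr0 (nth_map a0) // !ffunE scale_lfunE /E eqxx id_lfunE => <-.
  by rewrite [_ *: _]mulr1.
have l'D : (l' < size (enum D))%N by rewrite -[X in (_ < X)%N](size_map (fun a => [ffun c => E a c])).
rewrite (nth_map a0) // !ffunE scale_lfunE /E nth_uniq ?enum_uniq //.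
by rewrite eq_sym (negPf (_ : val l' != val l)) // zero_lfunE scaler0.
Qed.

End Modules.

Arguments idem {k m Q}.
Arguments act {k m Q}.
Arguments simple_mod k {m} Q i.
Arguments zero_mod k {m} Q.

Section FiniteSubspaces.
Variables (k : finFieldType) (V : vectType k).
HB.instance Definition _ := Countable.copy {vspace V}
  (can_type (@VectorInternalTheory.vs2mxK k V)).
HB.instance Definition _ : isFinite {vspace V} :=
  CanIsFinite (@VectorInternalTheory.vs2mxK k V).
End FiniteSubspaces.

Section Submodules.
Variables (k : finFieldType) (m : nat) (Q : quiver m) (M : kmod k Q).
Implicit Types U W : {vspace M}.

Definition submodule U : bool :=
  [forall i, (idem M i @: U <= U)%VS] && [forall a, (act M a @: U <= U)%VS].

Definition dim_vec U : 'cV[int]_m := \col_i (\dim (idem M i @: U))%:Z.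

Definition Gr (e : 'cV[int]_m) : {set {vspace M}} :=
  [set U | submodule U & dim_vec U == e].

Definition maximal_submodule U : bool :=
  [&& submodule U, U != fullv
    & [forall W, submodule W && (U <= W)%VS ==> (W == U) || (W == fullv)]].

Definition simple_submodule U : bool :=
  [&& submodule U, U != 0%VS
    & [forall W, submodule W && (W <= U)%VS ==> (W == 0%VS) || (W == U)]].

Definition radical : {vspace M} := (\bigcap_(U | maximal_submodule U) U)%VS.
Definition socle : {vspace M} := (\sum_(U | simple_submodule U) U)%VS.

Definition dim_top : 'cV[int]_m := dim_vec fullv - dim_vec radical.
End Submodules.

(* PJ is projective with PJ / rad PJ isomorphic to soc J: the isomorphism is
   encoded by a morphism PJ -> J with kernel rad PJ and image soc J. *)
Definition proj_of_inj (k : finFieldType) m (Q : quiver m) (J PJ : kmod k Q) : Prop :=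
  projective PJ /\
  exists2 h : 'Hom(PJ, J), h \in homs PJ J & lker h = radical PJ /\ limg h = socle J.

Section CalderoChapoton.
Variables (k : finFieldType) (n m : nat) (le_nm : (n <= m)%N) (Q : quiver m).

Definition Btilde : 'M[int]_(m, n) := \matrix_(i, j)
  (#|[set a : arr Q | (src a == i) && (tgt a == widen_ord le_nm j)]|%:Z
   - #|[set a : arr Q | (src a == widen_ord le_nm j) && (tgt a == i)]|%:Z).

Definition Rtilde : 'M[int]_(m, n) :=
  \matrix_(i, j) (ext1_dim (simple_mod k Q i) (simple_mod k Q (widen_ord le_nm j)))%:Z.

Definition Itilde : 'M[int]_(m, n) := pid_mx n.

(* The Euler form on dimension vectors: the bilinear form on Z^m with value
   <S_i, S_j> at the dimension vectors of S_i and S_j. *)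
Definition euler_form (x y : 'cV[int]_m) : int :=
  \sum_i \sum_j x i 0 * y j 0 * euler (simple_mod k Q i) (simple_mod k Q j).

Variable L : 'M[int]_m.

(* X_(M + P[1]).  Every dimension vector of a submodule of M has entries at most
   \dim M, so v ranges over all e with nonempty Gr_e M. *)
Definition CC (M : kmod k (full_sub n Q)) (P : kmod k Q) : qtorus k L :=
  let d := dim_vec (fullv : {vspace M}) in
  \sum_(v : 'cV['I_(\dim (fullv : {vspace M})).+1]_n)
    let e := map_mx (fun j : 'I__ => (j : nat)%:Z) v in
    (#|Gr M e|%:R * qhalf k (- euler_form (Itilde *m e) (Itilde *m (d - e)))) *:
      qX k L (Btilde *m e - (Itilde - Rtilde) *m d + dim_top P).
End CalderoChapoton.

Lemma CC_zero (k : finFieldType) n m (le_nm : (n <= m)%N) (Q : quiver m) L P :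
  CC le_nm L (zero_mod k (full_sub n Q)) P = qX k L (dim_top P).
Proof.
set Z := zero_mod k (full_sub n Q).
have Zv (U : {vspace Z}) : U = 0%VS.
  by apply/eqP; rewrite -subv0; apply/subvP => x _; rewrite [x]thinmx0 mem0v.
have f0 : (fullv : {vspace Z}) = 0%VS by apply: Zv.
have dv0 (U : {vspace Z}) : dim_vec U = 0.
  by apply/matrixP => i j; rewrite !mxE (Zv (_ @: _)%VS) dimv0.
rewrite /CC; have d0 : \dim (fullv : {vspace Z}) = 0%N by rewrite f0 dimv0.
rewrite (big_pred1 (const_mx ord0)); last first.
  move=> v /=; apply/esym/eqP/matrixP => i j; rewrite mxE; apply: val_inj => /=.
  by have := ltn_ord (v i j); rewrite [X in (_ < X.+1)%N]d0 ltnS leqn0 => /eqP.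
rewrite dv0 (_ : map_mx _ _ = 0); last by apply/matrixP => i j; rewrite !mxE.
rewrite subr0 !mulmx0 subr0 add0r (_ : euler_form _ _ _ _ = 0); last first.
  by rewrite /euler_form big1 // => i _; rewrite big1 // => j _; rewrite !mxE !mul0r.
rewrite oppr0 qhalf0 mulr1 (_ : #|_| = 1%N) ?scale1r //.
apply/eqP/cards1P; exists 0%VS; apply/setP => U; rewrite !inE (Zv U) dv0 !eqxx andbT.
by apply/andP; split; apply/forallP => i; rewrite limg0 subv0.
Qed.

(* Main.v *)
From HB Require Import structures.
Require Import Defs.
From mathcomp Require Import all_boot all_order all_algebra all_field.
From mathcomp Require Import ring.

(** Fix a projective [P], let [t] be the dimension vector of its top and let
    [I] be its Nakayama image.  Write [E] for the matrix of the Euler form on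
    simple modules.  Then [Btilde = (E - E^T) Itilde] and
    [Itilde - Rtilde = E Itilde], so that the monomial attached to a submodule
    [U] of [M] (of dimension vectors [u] and [m]) is [X^(- E^T u - E (m - u))],
    and the Caldero-Chapoton sum runs over the submodules of [M] one by one.

    Multiplying by [X^t] on the left turns the coefficient of [U] into
    [q^(c/2 - t.u/2)] times the old one, because [L] inverts [- Btilde].  Since
    [P] is projective, [t.u] is the dimension of [Hom(P, U)]; it is at most
    [t.m = 1].  The submodules of [M] thus fall into two classes:
    - those with [t.u = 0], which are the submodules of [B = ker g]: a submodule
      with nonzero image in [I] has an image meeting the socle of [I], whose
      dimension vector is again [t];
    - those with [t.u = 1], which are the submodules containing [im f], that is,
      the preimages of the submodules of [A].
    The first class yields the character of [B] and the second one that of [A].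
    What has to be compared are the monomials and the Euler exponents.

    For a module [X] such that [Ext^1(X, -)] vanishes, [E^T (dim X)] is the
    dimension vector of the top of [X] ([dim_top_euler]).  This applies to [P]
    ([projective_ext]) and to its submodule [P'] ([ext_vanishes_sub]), and gives
    [E^T (dim (im f)) = t - top P'].  Dually, [E (dim J)] is the dimension
    vector of the socle of [J] as soon as elements can be lifted simultaneously
    along all arrows with a given target ([dim_socle_lifting]).  This property
    holds for [I] ([nakayama_lifting]) and is inherited by its quotient [I'],
    whence [E (dim (im g)) = t - soc I'].  The two assumptions
    [Hom(B, I') = 0] and [Hom(P', A) = 0] bound the values of the Euler form on
    [(B, I')] and [(P', A)] from above, hence force [soc I'] to be orthogonal to
    the dimension vectors of all submodules of [B], and [top P'] to be
    orthogonal to those of all subquotients of [A].  This is exactly what makes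
    the exponents agree. *)

Set Implicit Arguments.
Unset Strict Implicit.
Unset Printing Implicit Defensive.

Import Order.TTheory GRing.Theory Num.Theory.
Local Open Scope ring_scope.

(** * Dimension counts in linear algebra *)

Section LinearAlgebra.
Variable k : fieldType.

Lemma memv_idem (V : vectType k) (e : 'End(V)) x :
  (e \o e)%VF = e -> (x \in limg e) = (e x == x).
Proof.
move=> ee; apply/idP/eqP => [/memv_imgP[y _ ->]|<-]; last exact: memv_img (memvf _).
by rewrite -comp_lfunE ee.
Qed.

(** Restricting a linear map to [U] and corestricting it to [T] is enough for a
    dimension count; this avoids building the restricted isomorphism. *)
Lemma dimv_iso (V W : vectType k) (f : 'Hom(V, W)) (U : {vspace V}) (T : {vspace W}) :
  {in U, forall x, f x \in T} -> {in U, forall x, f x = 0 -> x = 0} ->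
  {in T, forall y, exists2 x, x \in U & f x = y} -> \dim T = \dim U.
Proof.
move=> fU f0 fT; rewrite -[RHS](@limg_dim_eq _ _ _ f).
  congr (\dim _); apply: subv_anti; apply/andP; split; apply/subvP => y.
    by move=> /fT[x xU <-]; apply: memv_img.
  by case/memv_imgP => x xU ->; apply: fU.
apply/eqP; rewrite -subv0; apply/subvP => x; rewrite memv_cap memv_ker memv0.
by case/andP => xU /eqP /(f0 _ xU) ->.
Qed.

Lemma dimv_ffun (I : finType) (W : vectType k) (U : {vspace {ffun I -> W}})
    (Us : I -> {vspace W}) :
  (forall y, (y \in U) = [forall i, y i \in Us i]) ->
  \dim U = (\sum_i \dim (Us i))%N.
Proof.
move=> UE; pose single i (x : W) : {ffun I -> W} := [ffun j => if j == i then x else 0].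
have single_lin i : linear (single i).
  move=> c x y; apply/ffunP => j; rewrite !ffunE.
  by case: eqP => // _; rewrite scaler0 addr0.
pose sL i := GRing.isLinear.Build k _ _ _ _ (single_lin i).
pose s i : 'Hom(W, {ffun I -> W}) :=
  linfun (HB.pack_for {linear W -> {ffun I -> W}} (single i) (sL i)).
have sE i x : s i x = single i x by rewrite lfunE.
have -> : U = (\sum_i (s i @: Us i))%VS.
  apply: subv_anti; apply/andP; split; last first.
    apply/subv_sumP => i _; apply/subvP => _ /memv_imgP[x xU ->].
    rewrite UE sE; apply/forallP => j; rewrite ffunE.
    by case: eqP => [->|_]; rewrite ?mem0v.
  apply/subvP => y; rewrite UE => /forallP yU.
  have -> : y = \sum_i s i (y i).
    apply/ffunP => j; rewrite sum_ffunE (bigD1 j) //= sE ffunE eqxx big1 ?addr0 //.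
    by move=> i ne; rewrite sE ffunE eq_sym (negPf ne).
  by apply: memv_sumr => i _; apply: memv_img.
have /directvP /= -> : directv (\sum_i (s i @: Us i))%VS.
  apply/directv_sum_independent => us usU us0 i _.
  have coord l j : j != l -> us l j = 0.
    by case/memv_imgP: (usU l isT) => x _ ->; rewrite sE ffunE => /negPf ->.
  apply/ffunP => j; rewrite ffunE; case: (eqVneq j i) => [->|/coord //].
  have := congr1 (fun y : {ffun I -> W} => y i) us0.
  rewrite /= sum_ffunE ffunE (bigD1 i) //= big1 ?addr0 // => l ne.
  by rewrite coord // eq_sym.
apply: eq_bigr => i _; rewrite limg_dim_eq //.
apply/eqP; rewrite -subv0; apply/subvP => x; rewrite memv_cap memv_ker memv0 sE.
by case/andP=> _ /eqP/ffunP/(_ i); rewrite !ffunE eqxx => ->.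
Qed.

(** Maps fixed by sandwiching between idempotents are the same as maps between
    the images of these idempotents. *)
Lemma dimv_block (V W : vectType k) (e : 'End(V)) (e' : 'End(W)) (U : {vspace 'Hom(V, W)}) :
  (e \o e)%VF = e -> (e' \o e')%VF = e' ->
  (forall h, (h \in U) = ((e' \o h \o e)%VF == h)) ->
  \dim U = (\dim (limg e) * \dim (limg e'))%N.
Proof.
move=> ee e'e' UE; set A := limg e; set B := limg e'.
pose F (h : 'Hom(V, W)) : 'Hom(subvs_of A, subvs_of B) :=
  (linfun (vsproj B) \o h \o linfun vsval)%VF.
have F_lin : linear F.
  by move=> c x y; rewrite /F comp_lfunDr comp_lfunDl -comp_lfunZr -comp_lfunZl.
pose FL := GRing.isLinear.Build k _ _ _ _ F_lin.
pose f := linfun (HB.pack_for {linear 'Hom(V, W) -> 'Hom(subvs_of A, subvs_of B)} F FL).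
rewrite -(@dimv_iso _ _ f U fullv); first 1 last.
- by move=> x _; rewrite memvf.
- move=> h; rewrite UE lfunE /= => /eqP hE F0; rewrite -hE.
  apply/lfunP => x; rewrite zero_lfunE !comp_lfunE /=.
  have exA : e x \in A by apply: memv_img (memvf _).
  have := congr1 (fun G : 'Hom(_, _) => vsval (G (vsproj A (e x)))) F0.
  rewrite /F /= !comp_lfunE !lfunE /= (vsprojK exA).
  rewrite -{1}hE !comp_lfunE vsprojK ?memv_img ?memvf //.
  by rewrite -[e (e x)]comp_lfunE ee.
- move=> G _; exists (linfun vsval \o G \o linfun (vsproj A) \o e)%VF.
    rewrite UE; apply/eqP/lfunP => x; rewrite !comp_lfunE !lfunE /=.
    rewrite -[e (e x)]comp_lfunE ee.
    by apply/eqP; rewrite -memv_idem // subvsP.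
  apply/lfunP => x; rewrite lfunE /= /F !comp_lfunE !lfunE /=.
  have := subvsP x; rewrite -/A memv_idem // => /eqP ->.
  by rewrite !vsvalK.
by rewrite dimvf.
Qed.

Definition sandwich (V W : vectType k) (e : 'End(V)) (e' : 'End(W)) (h : 'Hom(V, W)) :
  'Hom(V, W) := (e' \o h \o e)%VF.

Fact sandwich_linear V W e e' : linear (@sandwich V W e e').
Proof.
move=> c x y; rewrite /sandwich comp_lfunDr comp_lfunDl.
by rewrite -comp_lfunZr -comp_lfunZl.
Qed.
HB.instance Definition _ V W e e' :=
  GRing.isLinear.Build k _ _ _ _ (@sandwich_linear V W e e').

Lemma mem_sandwich (V W : vectType k) (e : 'End(V)) (e' : 'End(W)) h :
  (e \o e)%VF = e -> (e' \o e')%VF = e' ->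
  (h \in limg (linfun (sandwich e e'))) = (sandwich e e' h == h).
Proof.
move=> ee e'e'; rewrite memv_idem ?lfunE //; apply/lfunP => x.
rewrite comp_lfunE !lfunE /= /sandwich !comp_lfunA e'e'.
by rewrite -(comp_lfunA _ e e) ee.
Qed.

Lemma dim_sandwich (V W : vectType k) (e : 'End(V)) (e' : 'End(W)) :
  (e \o e)%VF = e -> (e' \o e')%VF = e' ->
  \dim (limg (linfun (sandwich e e'))) = (\dim (limg e) * \dim (limg e'))%N.
Proof. by move=> ee e'e'; apply: dimv_block => // h; rewrite mem_sandwich. Qed.

(** With [e] a projection of kernel [K], vanishing on [K] means [h \o e = h], so
    this is a case of [dimv_block]. *)
Lemma dim_annihilator (V W : vectType k) (K : {vspace V}) (U : {vspace 'Hom(V, W)}) :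
  (forall h, (h \in U) = (K <= lker h)%VS) ->
  \dim U = ((\dim {:V} - \dim K) * \dim {:W})%N.
Proof.
move=> UE; pose e : 'End(V) := \1%VF - projv K.
have eE x : e x = x - projv K x by rewrite add_lfunE opp_lfunE id_lfunE.
have eK x : x \in K -> e x = 0 by move=> xK; rewrite eE projv_id ?subrr.
have kerE : lker e = K.
  apply/vspaceP => x; rewrite memv_ker; apply/eqP/idP => [|/eK //].
  by rewrite eE => /eqP; rewrite subr_eq0 => /eqP ->; apply: memv_proj.
rewrite (@dimv_block _ _ e \1%VF); first 1 last.
- apply/lfunP => x; rewrite comp_lfunE [X in e X]eE linearB /=.
  by rewrite [e (projv K x)]eK ?memv_proj // subr0.
- by rewrite comp_lfun1l.
- move=> h; rewrite UE comp_lfun1l; apply/subvP/eqP => [hK|hE x xK].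
    apply/lfunP => x; rewrite comp_lfunE eE linearB /=.
    have := hK _ (memv_proj K x); rewrite memv_ker => /eqP ->.
    by rewrite subr0.
  by rewrite memv_ker -hE comp_lfunE eK // linear0.
congr (_ * _)%N; last by rewrite lim1g.
have := limg_ker_dim e fullv; rewrite capfv kerE => <-.
by rewrite addKn.
Qed.

End LinearAlgebra.

(** * The Euler form of the path algebra *)

Section EulerForm.
Variables (k : finFieldType) (m : nat) (Q : quiver m).
Implicit Types M N X : kmod k Q.

Definition vdim M i : nat := \dim (limg (idem M i)).

Lemma idem_idem M i : (idem M i \o idem M i)%VF = idem M i.
Proof. by rewrite idemM eqxx. Qed.

Lemma idemE M i j x : idem M i (idem M j x) = if i == j then idem M i x else 0.
Proof. by rewrite -comp_lfunE idemM; case: eqP => //; rewrite zero_lfunE. Qed.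

Lemma idem_sumE M x : \sum_i idem M i x = x.
Proof. by rewrite -sum_lfunE idem_sum id_lfunE. Qed.

Lemma act_tgt M a x : act M a (idem M (tgt a) x) = act M a x.
Proof. by rewrite -act_idem !comp_lfunE idemE eqxx. Qed.

Lemma idem_act M a x : idem M (src a) (act M a x) = act M a x.
Proof. by rewrite -act_idem !comp_lfunE idemE eqxx. Qed.

(** A graded map is determined by its diagonal blocks, which are arbitrary. *)
Lemma dim_graded_homs M N :
  \dim (graded_homs M N) = (\sum_i vdim M i * vdim N i)%N.
Proof.
pose F (h : 'Hom(M, N)) : {ffun 'I_m -> 'Hom(M, N)} :=
  [ffun i => sandwich (idem M i) (idem N i) h].
have F_lin : linear F.
  by move=> c x y; apply/ffunP => i; rewrite !ffunE linearP.
pose f := linfun (HB.pack_for {linear 'Hom(M, N) -> {ffun 'I_m -> 'Hom(M, N)}} F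
  (GRing.isLinear.Build k _ _ _ _ F_lin)).
have fE h i : f h i = sandwich (idem M i) (idem N i) h.
  by rewrite lfunE /= ffunE.
rewrite -(@limg_dim_eq _ _ _ f); last first.
  apply/eqP; rewrite -subv0; apply/subvP => h; rewrite memv_cap memv_ker memv0.
  case/andP => /graded_homsP hG /eqP f0; apply/eqP/lfunP => x.
  rewrite zero_lfunE -(idem_sumE x) linear_sum big1 // => i _.
  have := congr1 (fun y : {ffun 'I_m -> 'Hom(M, N)} => y i x) f0.
  rewrite /= fE ffunE zero_lfunE /sandwich !comp_lfunE.
  by rewrite -[h _]comp_lfunE hG !comp_lfunE idemE eqxx.
rewrite (@dimv_ffun _ _ _ _ (fun i => limg (linfun (sandwich (idem M i) (idem N i))))).
  by apply: eq_bigr => i _; rewrite dim_sandwich ?idem_idem.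
move=> y; apply/idP/forallP => [/memv_imgP[h _ ->] i|yU].
  rewrite fE -[X in X \in _](lfunE (sandwich (idem M i) (idem N i))).
  exact: memv_img (memvf _).
have {}yU i : sandwich (idem M i) (idem N i) (y i) = y i.
  by apply/eqP; rewrite -mem_sandwich ?idem_idem.
have yl i j x : idem N j (y i x) = if j == i then y i x else 0.
  by rewrite -(yU i) !comp_lfunE idemE; case: eqP => [->|].
have yr i j x : y i (idem M j x) = if i == j then y i x else 0.
  by rewrite -(yU i) !comp_lfunE idemE; case: eqP => [->|]; rewrite ?linear0.
have -> : y = f (\sum_i y i).
  apply/ffunP => j; rewrite fE; apply/lfunP => x; rewrite !comp_lfunE sum_lfunE.
  rewrite linear_sum (bigD1 j) //= yl eqxx yr eqxx big1 ?addr0 // => i ne.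
  by rewrite yl eq_sym (negPf ne).
apply: memv_img; apply/graded_homsP => i; apply/lfunP => x.
rewrite !comp_lfunE !sum_lfunE linear_sum /=; apply: eq_bigr => j _.
by rewrite yl yr eq_sym.
Qed.

Lemma dim_cocycles M N :
  \dim (cocycles M N) = (\sum_(a : arr Q) vdim M (tgt a) * vdim N (src a))%N.
Proof.
rewrite (@dimv_ffun _ _ _ _
  (fun a => limg (linfun (sandwich (idem M (tgt a)) (idem N (src a)))))).
  by apply: eq_bigr => a _; rewrite dim_sandwich ?idem_idem.
move=> y; apply/idP/forallP => [/memv_imgP[h _ ->] a|yU].
  rewrite lfunE /= ffunE -[X in X \in _](lfunE (sandwich (idem M (tgt a)) (idem N (src a)))).
  exact: memv_img (memvf _).
have -> : y = linfun (@arrow_block _ _ _ M N) y; last exact: memv_img (memvf _).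
apply/ffunP => a; rewrite lfunE ffunE; apply/esym/eqP.
by rewrite -[X in X == _]/(sandwich _ _ _) -mem_sandwich ?idem_idem.
Qed.

(** Without this inclusion the subtraction of natural numbers in [ext1_dim]
    could be truncated. *)
Lemma coboundary_cocycle M N h :
  h \in graded_homs M N -> coboundary M N h \in cocycles M N.
Proof.
move/graded_homsP => hG.
have -> : coboundary M N h = linfun (@arrow_block _ _ _ M N) (coboundary M N h).
  apply/ffunP => a; rewrite lfunE [in RHS]lfunE !ffunE /=; apply/lfunP => x.
  rewrite !comp_lfunE !add_lfunE !opp_lfunE !comp_lfunE linearB /= act_tgt.
  rewrite -[idem N _ (h _)]comp_lfunE -hG comp_lfunE idem_act.
  by rewrite -[h (idem M _ _)]comp_lfunE hG comp_lfunE act_tgt idem_act.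
exact: memv_img (memvf _).
Qed.

Lemma coboundaries_sub M N : (coboundary M N @: graded_homs M N <= cocycles M N)%VS.
Proof. by apply/subvP => _ /memv_imgP[h hG ->]; apply: coboundary_cocycle. Qed.

(** The standard projective resolution, read off dimensions: the coboundary goes
    from graded maps to cocycles, has kernel [Hom] and cokernel [Ext^1]. *)
Lemma eulerE M N : euler M N =
  \sum_i (vdim M i)%:Z * (vdim N i)%:Z - \sum_(a : arr Q) (vdim M (tgt a))%:Z * (vdim N (src a))%:Z.
Proof.
have H := limg_ker_dim (coboundary M N) (graded_homs M N).
have [le_c _] := dimv_leqif_sup (coboundaries_sub M N).
rewrite /euler /hom_dim /ext1_dim /homs -subzn //.
have -> : (\dim (graded_homs M N :&: lker (coboundary M N)))%:Z =
   (\dim (graded_homs M N))%:Z - (\dim (coboundary M N @: graded_homs M N))%:Z :> int.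
  by rewrite -H PoszD addrK.
rewrite dim_graded_homs dim_cocycles opprB addrA subrK.
rewrite !(big_morph Posz PoszD (erefl _)).
by congr (_ - _); apply: eq_bigr => i _; rewrite PoszM.
Qed.

Lemma vdim_simple i j : vdim (simple_mod k Q i) j = (j == i).
Proof.
rewrite /vdim /=; case: (eqVneq j i) => _; last by rewrite lim0g dimv0.
by rewrite lim1g dimvf.
Qed.

Definition euler_mx : 'M[int]_m :=
  \matrix_(i, j) euler (simple_mod k Q i) (simple_mod k Q j).

Lemma euler_mxE i j :
  euler_mx i j = (i == j)%:R - \sum_(a : arr Q) ((src a == j) && (tgt a == i))%:R.
Proof.
rewrite mxE eulerE; congr (_ - _).
  rewrite (bigD1 i) //= !vdim_simple eqxx mul1r big1 ?addr0 ?natz // => l ne.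
  by rewrite vdim_simple (negPf ne) mul0r.
apply: eq_bigr => a _; rewrite !vdim_simple andbC -mulnb natrM.
by congr (_ * _); rewrite natz.
Qed.

Lemma euler_formE x y : euler_form k Q x y = (x^T *m euler_mx *m y) 0 0.
Proof.
rewrite /euler_form -mulmxA mxE; apply: eq_bigr => i _.
rewrite !mxE mulr_sumr; apply: eq_bigr => j _.
by rewrite !mxE -mulrA [y j 0 * _]mulrC.
Qed.

Definition dim_mod M : 'cV[int]_m := dim_vec (fullv : {vspace M}).

Lemma dim_modE M i : dim_mod M i 0 = (vdim M i)%:Z.
Proof. by rewrite mxE. Qed.

Lemma euler_mx_mulE M t : (euler_mx *m dim_mod M) t 0 =
  (vdim M t)%:Z - \sum_(a : arr Q | tgt a == t) (vdim M (src a))%:Z.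
Proof.
rewrite mxE; under eq_bigr do rewrite euler_mxE dim_modE mulrBl mulr_suml.
rewrite big_split /= sumrN; congr (_ - _).
  rewrite (bigD1 t) //= eqxx mul1r big1 ?addr0 // => i ne.
  by rewrite eq_sym (negPf ne) mul0r.
rewrite exchange_big [RHS]big_mkcond; apply: eq_bigr => a _ /=.
rewrite (bigD1 (src a)) //= eqxx big1 => [|i ne].
  by rewrite addr0; case: eqP; rewrite ?mul1r ?mul0r.
by rewrite eq_sym (negPf ne) mul0r.
Qed.

Lemma euler_euler_form M N : euler M N = euler_form k Q (dim_mod M) (dim_mod N).
Proof.
rewrite euler_formE -mulmxA mxE; under [RHS]eq_bigr do rewrite euler_mx_mulE mxE dim_modE.
rewrite eulerE; under [RHS]eq_bigr do rewrite mulrBr.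
rewrite big_split /= sumrN; congr (_ - _).
under [RHS]eq_bigr do rewrite mulr_sumr big_mkcond.
rewrite exchange_big; apply: eq_bigr => a _ /=.
rewrite -big_mkcond /= (big_pred1 (tgt a)) // => i.
Qed.

Lemma dim_mod_simple i : dim_mod (simple_mod k Q i) = delta_mx i 0.
Proof. by apply/matrixP => j l; rewrite (ord1 l) dim_modE vdim_simple !mxE andbT natz. Qed.

Lemma euler_to_simple M j : euler M (simple_mod k Q j) = (euler_mx^T *m dim_mod M) j 0.
Proof.
rewrite euler_euler_form euler_formE dim_mod_simple -[in LHS](trmxK euler_mx) -trmx_mul.
by rewrite -colE !mxE.
Qed.

End EulerForm.

(** * Submodules, radical and socle over an acyclic quiver *)

Section Submodules.
Variables (k : finFieldType) (m : nat) (Q : quiver m).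
Implicit Types M N X : kmod k Q.

Lemma hom_idem M N h i x : h \in homs M N -> h (idem M i x) = idem N i (h x).
Proof. by case/homsP => hi _; rewrite -!comp_lfunE hi. Qed.

Lemma hom_act M N h a x : h \in homs M N -> h (act M a x) = act N a (h x).
Proof. by case/homsP => _ ha; rewrite -!comp_lfunE ha. Qed.

Lemma homs_comp M N X f h : f \in homs M N -> h \in homs N X -> (h \o f)%VF \in homs M X.
Proof.
move=> fH hH; apply/homsP; split=> [i|a]; apply/lfunP => x; rewrite !comp_lfunE.
  by rewrite (hom_idem _ _ fH) (hom_idem _ _ hH).
by rewrite (hom_act _ _ fH) (hom_act _ _ hH).
Qed.

Lemma submoduleP M (U : {vspace M}) :
  reflect ((forall i x, x \in U -> idem M i x \in U) /\
           (forall a x, x \in U -> act M a x \in U)) (submodule U).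
Proof.
apply: (iffP andP) => [[/forallP Hi /forallP Ha]|[Hi Ha]]; split.
- by move=> i x xU; apply: (subvP (Hi i)); apply: memv_img.
- by move=> a x xU; apply: (subvP (Ha a)); apply: memv_img.
- by apply/forallP => i; apply/subvP => _ /memv_imgP[x xU ->]; apply: Hi.
- by apply/forallP => a; apply/subvP => _ /memv_imgP[x xU ->]; apply: Ha.
Qed.

Lemma submodule_idem M (U : {vspace M}) i x : submodule U -> x \in U -> idem M i x \in U.
Proof. by case/submoduleP => H _; apply: H. Qed.

Lemma submodule_act M (U : {vspace M}) a x : submodule U -> x \in U -> act M a x \in U.
Proof. by case/submoduleP => _; apply. Qed.

Lemma mem_idem_img M (U : {vspace M}) i x : submodule U ->
  (x \in (idem M i @: U)%VS) = (x \in U) && (idem M i x == x).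
Proof.
move=> sU; apply/memv_imgP/andP => [[y yU ->]|[xU /eqP xi]]; last by exists x.
by rewrite submodule_idem // idemE !eqxx.
Qed.

Lemma submodule_cap M (U W : {vspace M}) :
  submodule U -> submodule W -> submodule (U :&: W).
Proof.
move=> sU sW; apply/submoduleP; split=> [i|a] x; rewrite !memv_cap => /andP[xU xW].
  by rewrite !submodule_idem.
by rewrite !submodule_act.
Qed.

Lemma submodule_full M : submodule (fullv : {vspace M}).
Proof. by apply/submoduleP; split=> *; rewrite memvf. Qed.

Lemma submodule_img M N h (U : {vspace M}) :
  h \in homs M N -> submodule U -> submodule (h @: U)%VS.
Proof.
move=> hH sU; apply/submoduleP; split=> [i|a] _ /memv_imgP[x xU ->].
  by rewrite -(hom_idem _ _ hH) memv_img // submodule_idem.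
by rewrite -(hom_act _ _ hH) memv_img // submodule_act.
Qed.

Lemma submodule_preim M N h (W : {vspace N}) :
  h \in homs M N -> submodule W -> submodule (h @^-1: W)%VS.
Proof.
move=> hH sW; apply/submoduleP; split=> [i|a] x; rewrite -!memv_preim => xW.
  by rewrite (hom_idem _ _ hH) submodule_idem.
by rewrite (hom_act _ _ hH) submodule_act.
Qed.

Lemma submodule0 M : submodule (0 : {vspace M})%VS.
Proof. by apply/submoduleP; split=> ? x; rewrite !memv0 => /eqP ->; rewrite linear0. Qed.

Lemma submodule_ker M N h : h \in homs M N -> submodule (lker h).
Proof. by move=> hH; rewrite -lpreim0 (submodule_preim hH) ?submodule0. Qed.

(** Dimension vectors are additive on the exact sequence of [U] under [h]; all
    the dimension counts on exact sequences below are instances. *)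
Lemma dim_vec_ker_img M N h (U : {vspace M}) : h \in homs M N -> submodule U ->
  dim_vec U = dim_vec (U :&: lker h) + dim_vec (h @: U).
Proof.
move=> hH sU; apply/matrixP => i j; rewrite !mxE -PoszD; congr Posz.
have sK := submodule_ker hH.
rewrite -(limg_ker_dim h (idem M i @: U)%VS); congr (_ + _)%N; congr (\dim _).
  apply/vspaceP => x; rewrite memv_cap !mem_idem_img ?submodule_cap //.
  by rewrite memv_cap andbAC.
apply/vspaceP => y; apply/memv_imgP/memv_imgP => [[_ /memv_imgP[x xU ->] ->]|].
  by exists (h x); rewrite ?memv_img // (hom_idem _ _ hH).
case=> _ /memv_imgP[x xU ->] ->; exists (idem M i x); rewrite ?memv_img //.
by rewrite (hom_idem _ _ hH).
Qed.

Lemma dim_vecS M (U W : {vspace M}) i : (U <= W)%VS -> (dim_vec U i 0 <= dim_vec W i 0).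
Proof. by move=> sUW; rewrite !mxE lez_nat dimvS // limgS. Qed.

Lemma dim_vec_ge0 M (U : {vspace M}) i : 0 <= dim_vec U i 0.
Proof. by rewrite mxE. Qed.

Lemma dim_vec0 M : dim_vec (0 : {vspace M})%VS = 0.
Proof. by apply/matrixP => i j; rewrite !mxE limg0 dimv0. Qed.

Section SubmoduleModule.
Variables (M : kmod k Q) (U : {vspace M}) (sU : submodule U).

(** Only meaningful when [f] preserves [U]; the projection back onto [U] makes
    the restriction a total construction. *)
Definition sub_end (f : 'End(M)) : 'End(subvs_of U) :=
  (linfun (vsproj U) \o f \o linfun vsval)%VF.

Let sub_endE (f : 'End(M)) (x : subvs_of U) :
  f (vsval x) \in U -> vsval (sub_end f x) = f (vsval x).
Proof. by move=> fU; rewrite !comp_lfunE !lfunE /= vsprojK. Qed.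
Let idemU i (x : subvs_of U) : idem M i (vsval x) \in U.
Proof. by apply: submodule_idem => //; apply: subvsP. Qed.
Let actU a (x : subvs_of U) : act M a (vsval x) \in U.
Proof. by apply: submodule_act => //; apply: subvsP. Qed.

Fact sub_idemM i j : (sub_end (idem M i) \o sub_end (idem M j))%VF =
  if i == j then sub_end (idem M i) else 0.
Proof.
apply/lfunP => x; apply: subvs_inj; rewrite comp_lfunE.
rewrite [LHS]sub_endE // sub_endE // idemE.
by case: eqP => _; rewrite ?sub_endE // zero_lfunE linear0.
Qed.

Fact sub_idem_sum : \sum_i sub_end (idem M i) = \1%VF.
Proof.
apply/lfunP => x; apply: subvs_inj; rewrite sum_lfunE id_lfunE linear_sum /=.
by rewrite -[RHS](idem_sumE (vsval x)); apply: eq_bigr => i _; rewrite sub_endE.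
Qed.

Fact sub_act_idem a :
  (sub_end (idem M (src a)) \o sub_end (act M a) \o sub_end (idem M (tgt a)))%VF =
  sub_end (act M a).
Proof.
apply/lfunP => x; apply: subvs_inj; rewrite comp_lfunE comp_lfunE.
rewrite [LHS]sub_endE // [X in idem M _ X]sub_endE // [X in act M _ X]sub_endE //.
rewrite [RHS]sub_endE //.
by rewrite act_tgt idem_act.
Qed.

Definition submod : kmod k Q := Kmod sub_idemM sub_idem_sum sub_act_idem.

Definition submod_incl : 'Hom(submod, M) := linfun vsval.

Let submod_inclE x : submod_incl x = vsval x.
Proof. by rewrite lfunE. Qed.

Lemma submod_incl_hom : submod_incl \in homs submod M.
Proof.
apply/homsP; split=> [i|a]; apply/lfunP => x.
  rewrite comp_lfunE [RHS]comp_lfunE !submod_inclE; exact: sub_endE.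
rewrite comp_lfunE [RHS]comp_lfunE !submod_inclE; exact: sub_endE.
Qed.

Lemma submod_incl_ker : lker submod_incl = 0%VS.
Proof. by apply/eqP/lker0P => x y; rewrite !submod_inclE; apply: subvs_inj. Qed.

Lemma submod_incl_img : limg submod_incl = U.
Proof.
apply/vspaceP => x; apply/memv_imgP/idP => [[y _ ->]|xU].
  by rewrite submod_inclE subvsP.
by exists (vsproj U x); rewrite ?memvf // submod_inclE vsprojK.
Qed.

Lemma dim_mod_submod : dim_mod submod = dim_vec U.
Proof.
rewrite /dim_mod (dim_vec_ker_img submod_incl_hom (submodule_full _)).
by rewrite submod_incl_ker capv0 dim_vec0 add0r submod_incl_img.
Qed.
End SubmoduleModule.

Hypothesis Q_acyclic : acyclic_quiver Q.

Definition arrow_rel : rel 'I_m :=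
  [rel i j | [exists a : arr Q, (src a == i) && (tgt a == j)]].

(** Any vertex function that strictly increases along arrows would do.  Extremal
    vertices for it replace the nilpotency of the arrow ideal. *)
Definition height (i : 'I_m) : nat := #|[set j | connect arrow_rel j i]|.

Lemma arrow_relP (a : arr Q) : arrow_rel (src a) (tgt a).
Proof. by apply/existsP; exists a; rewrite !eqxx. Qed.

Lemma height_arrow (a : arr Q) : (height (src a) < height (tgt a))%N.
Proof.
apply: proper_card; apply/properP; split.
  apply/subsetP => j; rewrite !inE => c; apply: connect_trans c _.
  exact: connect1 (arrow_relP a).
exists (tgt a); rewrite inE ?connect0 //.
exact: Q_acyclic (arrow_relP a).
Qed.

(** Nakayama's lemma for the arrow ideal: if the images of the arrows together
    with a submodule [U] span the module, then [U] is everything.  Indeed arrows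
    act from their target to their source, so at a vertex of maximal height among
    those where [U] falls short, their images come from vertices where [U] is
    already full. *)
Lemma max_submodule_act M (U : {vspace M}) a x : maximal_submodule U -> act M a x \in U.
Proof.
case/and3P => sU U_proper /forallP maxU.
pose R := (\sum_(a : arr Q) (act M a @: fullv))%VS.
have actR b y : act M b y \in R.
  by apply: (subvP (sumv_sup b _ _)) => //; apply: memv_img (memvf _).
have sUR : submodule (U + R)%VS.
  apply/submoduleP; split=> [i|b] y; last first.
    by move=> _; apply: (subvP (addvSr U R)).
  case/memv_addP => u uU [_ /memv_sumP[v vR ->] ->].
  rewrite linearD /=; apply: memv_add; first exact: submodule_idem.
  rewrite linear_sum /=; apply: memv_suml => b _.
  case/memv_imgP: (vR b isT) => z _ ->; rewrite -idem_act idemE.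
  by case: eqP => [->|_]; rewrite ?mem0v ?idem_act.
have := maxU (U + R)%VS; rewrite sUR addvSl /= => /orP[/eqP <-|/eqP UR].
  exact: (subvP (addvSr U R)).
pose miss i := ~~ (limg (idem M i) <= U)%VS.
have [i0 i0P] : exists i, miss i.
  apply/existsP; apply: contraNT U_proper; rewrite negb_exists => /forallP H.
  rewrite eqEsubv subvf; apply/subvP => y _; rewrite -(idem_sumE y).
  apply: memv_suml => i _; have := H i; rewrite negbK => /subvP; apply.
  exact: memv_img (memvf _).
case: (arg_maxnP height i0P) => i iP imax; case/subvPn: iP => _ /memv_imgP[y _ ->] /negP[].
have : y \in (U + R)%VS by rewrite UR memvf.
case/memv_addP => u uU [_ /memv_sumP[v vR ->] ->].
rewrite linearD /=; apply: memvD; first exact: submodule_idem.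
rewrite linear_sum /=; apply: memv_suml => b _.
case/memv_imgP: (vR b isT) => z _ ->; rewrite -idem_act idemE.
case: eqP => [ib|]; last by rewrite mem0v.
rewrite ib idem_act -act_tgt submodule_act //.
have : ~~ miss (tgt b).
  by apply/negP => /imax /=; rewrite leqNgt ib height_arrow.
by rewrite negbK => /subvP; apply; apply: memv_img (memvf _).
Qed.

Lemma act_radical M a x : act M a x \in radical M.
Proof.
suff /subvP : (<[act M a x]> <= radical M)%VS by apply; apply: memv_line.
apply/subv_bigcapP => U mU; rewrite -memvE; exact: max_submodule_act.
Qed.

(** The kernel of a nonzero map to a simple module is a maximal submodule. *)
Lemma radical_ker M j h : h \in homs M (simple_mod k Q j) -> (radical M <= lker h)%VS.
Proof.
move=> hH; case: (eqVneq h 0) => [->|h0].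
  by apply/subvP => x _; rewrite memv_ker zero_lfunE.
apply: (bigcapv_inf (lker h)) => //; apply/and3P; split.
- exact: submodule_ker hH.
- apply: contra h0 => /eqP kf; apply/eqP/lfunP => x; rewrite zero_lfunE.
  by apply/eqP; rewrite -memv_ker kf memvf.
apply/forallP => W; apply/implyP => /andP[_ hW].
have := limg_ker_dim h fullv; rewrite capfv => dh.
have d1 : (\dim (limg h) <= 1)%N by apply: leq_trans (dimvS (subvf _)) _; rewrite dimvf.
rewrite eq_sym; case: (boolP (_ == W)) => //= neW.
have [le_hW] := dimv_leqif_eq hW; rewrite (negPf neW) => ne.
rewrite eqEdim subvf -dh /=.
have : (\dim (lker h) < \dim W)%N by rewrite ltn_neqAle ne.
by move=> lt; apply: leq_trans lt; rewrite -addn1 leq_add2l.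
Qed.

(** Maps to the simple module at [j] are the linear forms that vanish on the other
    components and on the radical. *)
Lemma hom_dim_simple M j : (hom_dim M (simple_mod k Q j))%:Z = dim_top M j 0.
Proof.
rewrite [RHS]mxE [X in _ + X]mxE !mxE; set R := radical M.
pose K := (idem M j @^-1: (idem M j @: R))%VS.
have memK x : (x \in K) = (idem M j x \in (idem M j @: R)%VS) by rewrite memv_preim.
rewrite /hom_dim (@dim_annihilator _ _ _ K); last first.
  move=> h; apply/idP/subvP => [hH x|hK].
    rewrite memK memv_ker => /memv_imgP[r rR xr].
    have hj y : h (idem M j y) = h y by rewrite (hom_idem _ _ hH) /= eqxx id_lfunE.
    rewrite -hj xr hj; have := subvP (radical_ker hH) _ rR.
    by rewrite memv_ker.
  have h0 x : x \in K -> h x = 0 by move/hK; rewrite memv_ker => /eqP.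
  apply/homsP; split=> [i|a]; apply/lfunP => x; rewrite !comp_lfunE /=.
    case: (eqVneq i j) => [->|ne]; rewrite ?id_lfunE ?zero_lfunE; last first.
      by rewrite h0 // memK idemE eq_sym (negPf ne) mem0v.
    have /h0 : idem M j x - x \in K.
      by rewrite memK linearB /= idemE eqxx subrr mem0v.
    by rewrite linearB /= => /eqP; rewrite subr_eq0 => /eqP.
  by rewrite zero_lfunE h0 // memK memv_img // act_radical.
have dK := limg_ker_dim (idem M j) K; have dM := limg_ker_dim (idem M j) fullv.
have KE : (K :&: lker (idem M j))%VS = lker (idem M j).
  by apply/capv_idPr; rewrite -lpreim0 lpreimS // sub0v.
move: dK dM; rewrite KE lpreimK ?limgS ?subvf // capfv => <- <-.
rewrite subnDl [\dim {:k^o}]dimvf muln1 subzn //.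
by rewrite dimvS // limgS ?subvf.
Qed.

Lemma simple_line M i x : x != 0 -> idem M i x = x -> (forall a, act M a x = 0) ->
  simple_submodule <[x]>%VS.
Proof.
move=> x0 xi xa; apply/and3P; split.
- apply/submoduleP; split=> [j|a] _ /vlineP[c ->]; rewrite linearZ /=.
    rewrite -xi idemE; case: ifP => [/eqP ->|_]; last by rewrite scaler0 mem0v.
    by rewrite xi memvZ ?memv_line.
  by rewrite xa scaler0 mem0v.
- by rewrite -dimv_eq0 dim_vline x0.
apply/forallP => W; apply/implyP => /andP[_ Wx].
rewrite -dimv_eq0 eqEdim Wx dim_vline x0 /=.
by case: (\dim W).
Qed.

(** At a vertex of minimal height where [U] is nonzero, all arrows act by zero. *)
Lemma submodule_socle_vector M (U : {vspace M}) : submodule U -> U != 0%VS ->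
  exists i x, [/\ x \in U, x != 0, idem M i x = x & forall a, act M a x = 0].
Proof.
move=> sU U0; pose hit i := (idem M i @: U)%VS != 0%VS.
have [i0 i0P] : exists i, hit i.
  apply/existsP; apply: contraNT U0; rewrite negb_exists => /forallP H.
  rewrite -subv0; apply/subvP => x xU; rewrite -(idem_sumE x) memv_suml // => i _.
  by have := H i; rewrite negbK => /eqP <-; apply: memv_img.
case: (arg_minnP height i0P) => i iU imin.
exists i; exists (vpick (idem M i @: U)%VS); set x := vpick _.
have : x \in (idem M i @: U)%VS by apply: memv_pick.
rewrite mem_idem_img // => /andP[xU /eqP xi].
split=> //; first by rewrite vpick0.
move=> a; rewrite -xi -act_tgt idemE; case: eqP => [ta|]; last by rewrite linear0.
have : ~~ hit (src a) by apply/negP => /imin /=; rewrite leqNgt -ta height_arrow.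
rewrite negbK => /eqP aU; apply/eqP; rewrite -memv0 -aU mem_idem_img //.
by rewrite idem_act eqxx andbT submodule_act // ta xi.
Qed.

Lemma socle_act M a x : x \in socle M -> act M a x = 0.
Proof.
suff /subvP H : (socle M <= lker (act M a))%VS by move/H; rewrite memv_ker => /eqP.
apply/subv_sumP => U /and3P[sU U0 /forallP Umin].
have [i [y [yU y0 yi ya]]] := submodule_socle_vector sU U0.
have := Umin <[y]>%VS; have /and3P[sy yn0 _] := simple_line y0 yi ya.
rewrite sy -memvE yU (negPf yn0) /= => /eqP <-.
by rewrite -memvE memv_ker ya.
Qed.

Lemma mem_socle M i x : idem M i x = x -> (forall a, act M a x = 0) -> x \in socle M.
Proof.
move=> xi xa; case: (eqVneq x 0) => [->|x0]; first exact: mem0v.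
apply: (subvP (sumv_sup <[x]>%VS _ (subvv _))); last exact: memv_line.
exact: simple_line xi xa.
Qed.

Lemma mem_idem_socle M i x :
  (x \in (idem M i @: socle M)%VS) = (idem M i x == x) && [forall a, act M a x == 0].
Proof.
apply/idP/andP => [/memv_imgP[y yS ->]|[/eqP xi /forallP xa]].
  rewrite idemE !eqxx; split=> //; apply/forallP => a.
  rewrite -act_tgt idemE; case: ifP => _; last by rewrite linear0.
  by rewrite act_tgt socle_act.
rewrite -xi memv_img // (mem_socle xi) // => a; exact/eqP.
Qed.

End Submodules.

(** * Vanishing of first extension groups *)

Section ExtVanishing.
Variables (k : finFieldType) (m : nat) (Q : quiver m).
Implicit Types M N P X : kmod k Q.

(** The vanishing of [Ext^1(X, N)], as the solvability of the coboundary equation: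
    this is the form in which it is proved and passes to submodules. *)
Definition ext_vanishes X N : Prop :=
  (cocycles X N <= coboundary X N @: graded_homs X N)%VS.

Lemma hom_dim_euler X N : ext_vanishes X N -> (hom_dim X N)%:Z = euler X N.
Proof. by move=> H; rewrite /euler /ext1_dim (eqP (dimvS H)) subr0. Qed.

(** The dimension of [Ext^1] is nonnegative; hence a vanishing Hom space bounds the
    Euler form from above. *)
Lemma euler_hom_dim X N : euler X N <= (hom_dim X N)%:Z.
Proof. by rewrite lerBlDr lerDl. Qed.

Lemma cocyclesP M N (xi : {ffun arr Q -> 'Hom(M, N)}) a x : xi \in cocycles M N ->
  xi a x = idem N (src a) (xi a (idem M (tgt a) x)).
Proof.
by case/memv_imgP => y _ ->; rewrite lfunE /= ffunE !comp_lfunE !idemE !eqxx.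
Qed.

Lemma mem_cocycles M N (xi : {ffun arr Q -> 'Hom(M, N)}) :
  (forall a, idem N (src a) \o xi a \o idem M (tgt a) = xi a)%VF -> xi \in cocycles M N.
Proof.
move=> H; have -> : xi = linfun (@arrow_block _ _ _ M N) xi; last exact: memv_img (memvf _).
by apply/ffunP => a; rewrite lfunE ffunE H.
Qed.

Section PairLfun.
Variables (U V W : vectType k) (f : 'Hom(U, V)) (g : 'Hom(U, W)).
Definition pair_fun (x : U) : (V * W)%type := (f x, g x).
Fact pair_fun_linear : linear pair_fun.
Proof. by move=> c x y; rewrite /pair_fun !linearP. Qed.
HB.instance Definition _ := GRing.isLinear.Build k _ _ _ _ pair_fun_linear.
Definition pair_lfun : 'Hom(U, (V * W)%type) := linfun pair_fun.
End PairLfun.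

Section Extension.
Variables (P N : kmod k Q) (xi : {ffun arr Q -> 'Hom(P, N)}).
Hypothesis xiP : xi \in cocycles P N.

Let E : vectType k := (N * P)%type.
Definition ext_fst : 'Hom(E, N) := linfun fst.
Definition ext_snd : 'Hom(E, P) := linfun snd.
Definition ext_idem i : 'End(E) := pair_lfun (idem N i \o ext_fst)%VF (idem P i \o ext_snd)%VF.
Definition ext_act (a : arr Q) : 'End(E) :=
  pair_lfun ((act N a \o ext_fst) + (xi a \o ext_snd))%VF (act P a \o ext_snd)%VF.

Lemma ext_idemE i x : ext_idem i x = (idem N i x.1, idem P i x.2).
Proof. by rewrite lfunE /= /pair_fun !comp_lfunE !lfunE. Qed.

Lemma ext_actE a x : ext_act a x = (act N a x.1 + xi a x.2, act P a x.2).
Proof. by rewrite lfunE /= /pair_fun add_lfunE !comp_lfunE !lfunE. Qed.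

Fact ext_idemM i j : (ext_idem i \o ext_idem j)%VF = if i == j then ext_idem i else 0.
Proof.
apply/lfunP => x; rewrite comp_lfunE !ext_idemE /= !idemE.
by case: eqP => _; rewrite ?ext_idemE // zero_lfunE.
Qed.

Fact ext_idem_sum : \sum_i ext_idem i = \1%VF.
Proof.
apply/lfunP => x; rewrite sum_lfunE id_lfunE [RHS]surjective_pairing.
rewrite -[x.1 in RHS]idem_sumE -[x.2 in RHS]idem_sumE.
under eq_bigr do rewrite ext_idemE.
by elim/big_rec3: _ => // i y1 y2 y3 _ ->.
Qed.

Fact ext_act_idem a : (ext_idem (src a) \o ext_act a \o ext_idem (tgt a))%VF = ext_act a.
Proof.
apply/lfunP => x; rewrite comp_lfunE comp_lfunE ext_idemE ext_actE ext_idemE /=.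
rewrite ext_actE !act_tgt idem_act linearD /= idem_act; congr (_ + _, _).
by rewrite -cocyclesP.
Qed.

Definition extension : kmod k Q := Kmod ext_idemM ext_idem_sum ext_act_idem.

Lemma ext_snd_hom : (ext_snd : 'Hom(extension, P)) \in homs extension P.
Proof.
apply/homsP; split=> [i|a]; apply/lfunP => x; rewrite comp_lfunE [RHS]comp_lfunE.
  by rewrite [idem extension i x]ext_idemE !lfunE.
by rewrite [act extension a x]ext_actE !lfunE.
Qed.

(** A section of the projection from the extension is a pair [(h, id)], and [h] is
    a solution of the coboundary equation. *)
Lemma split_extension : projective P -> xi \in (coboundary P N @: graded_homs P N)%VS.
Proof.
move=> P_proj.
have idP : (\1%VF : 'Hom(P, P)) \in homs P P.
  by apply/homsP; split=> i; rewrite comp_lfun1l comp_lfun1r.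
have snd_onto : limg (ext_snd : 'Hom(extension, P)) = fullv.
  apply/eqP; rewrite eqEsubv subvf; apply/subvP => x _.
  by apply/memv_imgP; exists ((0, x) : E); rewrite ?memvf // lfunE.
have [s sH sE] := P_proj _ _ _ _ ext_snd_hom snd_onto idP.
have s2 x : (s x : E).2 = x.
  by have := congr1 (fun h : 'End(P) => h x) sE; rewrite /= comp_lfunE lfunE id_lfunE.
apply/memv_imgP; exists (ext_fst \o s)%VF.
  apply/graded_homsP => i; apply/lfunP => x; rewrite !comp_lfunE (hom_idem _ _ sH).
  by rewrite [idem extension i _]ext_idemE !lfunE.
apply/ffunP => a; rewrite lfunE ffunE; apply/lfunP => x.
rewrite add_lfunE opp_lfunE !comp_lfunE (hom_act _ _ sH).
by rewrite [act extension a _]ext_actE !lfunE /= s2 addrAC subrr add0r.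
Qed.
End Extension.

Lemma projective_ext P N : projective P -> ext_vanishes P N.
Proof. by move=> P_proj; apply/subvP => xi xiP; apply: split_extension. Qed.

(** The category is hereditary: cocycles on a submodule extend to the whole module,
    and the solution there restricts. *)
Lemma ext_vanishes_sub P X N (i : 'Hom(X, P)) :
  i \in homs X P -> lker i = 0%VS -> ext_vanishes P N -> ext_vanishes X N.
Proof.
move=> iH /eqP ki /subvP eP; apply/subvP => xi xiX.
pose zeta : {ffun arr Q -> 'Hom(P, N)} :=
  [ffun a => (idem N (src a) \o (xi a \o i^-1) \o idem P (tgt a))%VF].
have zP : zeta \in cocycles P N.
  apply: mem_cocycles => a; rewrite ffunE; apply/lfunP => x.
  by rewrite !comp_lfunE !idemE !eqxx.
have /memv_imgP[h /graded_homsP hG zE] := eP _ zP.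
apply/memv_imgP; exists (h \o i)%VF.
  apply/graded_homsP => j; apply/lfunP => x.
  by rewrite !comp_lfunE (hom_idem _ _ iH) -[h _]comp_lfunE hG comp_lfunE.
apply/ffunP => a; apply/lfunP => x.
have := congr1 (fun y : {ffun arr Q -> 'Hom(P, N)} => y a (i x)) zE.
rewrite /= !lfunE !ffunE !add_lfunE !opp_lfunE !comp_lfunE.
rewrite -(hom_idem _ _ iH) (lker0_lfunK ki) -cocyclesP // => ->.
by rewrite (hom_act _ _ iH).
Qed.

(** Both sides compute [Hom(X, S_j)] for all [j]. *)
Lemma dim_top_euler X : acyclic_quiver Q ->
  (forall N, ext_vanishes X N) -> dim_top X = (euler_mx k Q)^T *m dim_mod X.
Proof.
move=> Qac eX; apply/matrixP => j l; rewrite (ord1 l) -hom_dim_simple //.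
by rewrite hom_dim_euler // euler_to_simple.
Qed.

Lemma euler_top X N : acyclic_quiver Q ->
  (forall N, ext_vanishes X N) -> euler X N = ((dim_top X)^T *m dim_mod N) 0 0.
Proof.
by move=> Qac eX; rewrite dim_top_euler // euler_euler_form euler_formE trmx_mul trmxK.
Qed.
End ExtVanishing.

(** * Right division by arrows in the path algebra *)

Section PathDivision.
Variables (k : finFieldType) (m : nat) (Q : quiver m).
Hypothesis Q_acyclic : acyclic_quiver Q.
Local Notation kQ := (pathalg k Q).
Implicit Types (a b : arr Q) (p r : qpath Q) (x y : kQ).

Lemma composable_height i (s : seq (arr Q)) : composable i s ->
  (height Q i + size s <= height Q (last i (map (@tgt _ Q) s)))%N.
Proof.
elim: s i => [|a s IHs] i /=; first by rewrite addn0.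
case/andP => /eqP <- /IHs; apply: leq_trans.
by rewrite addnS -addSn leq_add2r height_arrow.
Qed.

(** Strictness matters: a path can be prolonged by an arrow within the length
    bound built into [qpath]. *)
Lemma psize_lt p : (size (parrows p) < m)%N.
Proof.
have := composable_height (pcomposable p).
have le_m : (height Q (pend p) <= m)%N by rewrite -[leqRHS]card_ord max_card.
have gt0 : (0 < height Q (pstart p))%N.
  by apply/card_gt0P; exists (pstart p); rewrite inE connect0.
by move=> /leq_trans/(_ le_m); apply: leq_trans; rewrite -add1n leq_add2r.
Qed.

Definition path_rcons a r p : bool :=
  [&& pend r == src a, pstart r == pstart p & parrows p == rcons (parrows r) a].

Lemma path_rcons_tail a b r r' p : path_rcons a r p -> path_rcons b r' p -> a = b /\ r = r'.
Proof.
case/and3P => _ /eqP s1 /eqP e1 /and3P[_ /eqP s2 /eqP e2].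
move: e2; rewrite e1 => /rcons_inj[e2 ->]; split=> //.
by apply: qpath_inj; rewrite ?s1 ?s2.
Qed.

Lemma path_rcons_inj a r p p' : path_rcons a r p -> path_rcons a r p' -> p = p'.
Proof.
case/and3P => _ /eqP s1 /eqP e1 /and3P[_ /eqP s2 /eqP e2].
by apply: qpath_inj; rewrite -?s1 -?s2 ?e1 ?e2.
Qed.

Lemma path_rcons_ex a r : pend r = src a -> exists p, path_rcons a r p.
Proof.
move=> ra; have sz : (size (rcons (parrows r) a) <= m)%N by rewrite size_rcons psize_lt.
have cp : composable (pstart r) (rcons (parrows r) a).
  by rewrite -cats1 composable_cat pcomposable /= -/(pend r) ra eqxx.
by exists (mkpath sz cp); apply/and3P; split; rewrite ?ra.
Qed.

Lemma path_rcons_last p : parrows p != [::] -> exists a r, path_rcons a r p.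
Proof.
case E : _ / (lastP (parrows p)) => [//|s a] _.
have := psize p; have := pcomposable p; rewrite E -cats1 composable_cat size_cat /=.
case/and3P => cp /eqP ea _ sz.
have sz' : (size s <= m)%N by apply: leq_trans sz; apply: leq_addr.
by exists a, (mkpath sz' cp); apply/and3P; split=> //; apply/eqP.
Qed.

Lemma rmul_arrowE a x p : rmul (parrow k a) x p = \sum_(r | path_rcons a r p) x r.
Proof.
rewrite lfunE /= /rmul_fun ffunE.
rewrite -(pair_big_dep xpredT (fun r r' => is_concat r r' p) (fun r r' => x r * parrow k a r')) /=.
rewrite [RHS]big_mkcond; apply: eq_bigr => r _.
case: ifP => [/and3P[/eqP e1 /eqP e2 /eqP e3]|st].
  have sz : (size [:: a] <= m)%N by apply: leq_ltn_trans (psize_lt p); rewrite e3 size_rcons.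
  have cp : composable (src a) [:: a] by rewrite /= eqxx.
  rewrite (bigD1 (mkpath sz cp)) /=; last first.
    by apply/and3P; split; [apply/eqP | apply/eqP | rewrite e3 cats1].
  rewrite ffunE eqxx mulr1 big1 ?addr0 // => r' /andP[/and3P[_ /eqP s1 _]] /eqP ne.
  rewrite ffunE; case: eqP => [e|_]; rewrite ?mulr0 //; case: ne.
  by apply: qpath_inj; rewrite // -s1 e1.
apply: big1 => r' /and3P[/eqP s1 /eqP s2 /eqP s3]; rewrite ffunE.
case: eqP => [e|_]; last by rewrite mulr0.
case/negP: (negbT st); apply/and3P; split; [|exact/eqP|by rewrite -s3 e cats1].
by have := pcomposable r'; rewrite e /= andbT s2 eq_sym.
Qed.

(** Division is the transpose of right multiplication by [a] in the basis of
    paths; the sum has at most one term. *)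
Definition rdiv_fun a x : kQ := [ffun r => \sum_(p | path_rcons a r p) x p].

Fact rdiv_linear a : linear (rdiv_fun a).
Proof.
move=> c x y; apply/ffunP => r; rewrite !ffunE scaler_sumr -big_split /=.
by apply: eq_bigr => p _; rewrite !ffunE.
Qed.
HB.instance Definition _ a := GRing.isLinear.Build k _ _ _ _ (rdiv_linear a).

Definition rdiv a : 'End(kQ) := linfun (rdiv_fun a).

Lemma rdivE a x r : rdiv a x r = \sum_(p | path_rcons a r p) x p.
Proof. by rewrite lfunE /= ffunE. Qed.

Lemma sum_path_rcons a r p x : path_rcons a r p -> \sum_(p' | path_rcons a r p') x p' = x p.
Proof.
move=> st; rewrite (bigD1 p) //= big1 ?addr0 // => p' /andP[st' /eqP[]].
exact: path_rcons_inj st' st.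
Qed.

(** The last arrow of a path is well defined, so multiplying by [a] and dividing
    by [b] gives zero unless the arrows agree; when they do, only the
    paths that can be followed by [a] survive. *)
Lemma rdiv_rmul a b x :
  rdiv b (rmul (parrow k a) x) = if a == b then rmul (pvertex k Q (src a)) x else 0.
Proof.
apply/ffunP => r; rewrite rdivE.
have -> : (if a == b then rmul (pvertex k Q (src a)) x else 0) r =
    if (a == b) && (pend r == src b) then x r else 0.
  case: eqP => [->|_] /=; last by rewrite ffunE.
  by rewrite lfunE /= /rmul_fun mul_pvertex ffunE.
case: (pend r =P src b) => [rb|nrb]; last first.
  by rewrite andbF big1 // => p /and3P[/eqP /nrb].
have [p st] := path_rcons_ex rb; rewrite (sum_path_rcons _ st) rmul_arrowE andbT.
case: eqP => [ab|nab]; last first.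
  by rewrite big1 // => r' st'; have [/nab] := path_rcons_tail st' st.
rewrite (bigD1 r) /= ?ab // big1 ?addr0 // => r' /andP[st' /eqP[]].
by have [] := path_rcons_tail st' st.
Qed.

Definition trivial_free x : Prop := forall p, parrows p = [::] -> x p = 0.

(** The radical of the path algebra is the direct sum of the left ideals generated
    by the arrows. *)
Lemma rmul_rdiv_sum x : trivial_free x -> \sum_a rmul (parrow k a) (rdiv a x) = x.
Proof.
move=> x0; apply/ffunP => p; rewrite sum_ffunE.
under eq_bigr do rewrite rmul_arrowE.
case: (eqVneq (parrows p) [::]) => [p0|/path_rcons_last[a [r st]]].
  rewrite x0 // big1 // => a _; rewrite big1 // => r /and3P[_ _]; rewrite p0.
  by case: (parrows r).
rewrite (bigD1 a) //= [X in _ + X]big1 ?addr0 => [|b ne]; last first.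
  rewrite big1 // => r' st'; have [ba _] := path_rcons_tail st' st.
  by rewrite ba eqxx in ne.
rewrite (bigD1 r) //= big1 ?addr0 => [|r' /andP[st' ne]].
  by rewrite rdivE (sum_path_rcons _ st).
by have [_ rr] := path_rcons_tail st' st; rewrite rr eqxx in ne.
Qed.

Lemma rdiv_src a x : rmul (pvertex k Q (src a)) (rdiv a x) = rdiv a x.
Proof.
rewrite lfunE /= /rmul_fun mul_pvertex; apply/ffunP => r; rewrite ffunE rdivE.
by case: eqP => // nra; rewrite big1 // => p /and3P[/eqP].
Qed.

Lemma rmul_lmul x y z : rmul y (pmul z x) = pmul z (rmul y x).
Proof. by rewrite !lfunE /= /rmul_fun pmulA. Qed.

(** Division by [a] is the projection onto one summand of the decomposition
    [rmul_rdiv_sum], hence left linear on the radical. *)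
Lemma rdiv_lmul a x y : trivial_free x -> rdiv a (pmul y x) = pmul y (rdiv a x).
Proof.
move=> /rmul_rdiv_sum {1}<-; rewrite linear_sum linear_sum /= (bigD1 a) //=.
rewrite big1 ?addr0 => [|b ne].
  by rewrite -rmul_lmul rdiv_rmul eqxx rmul_lmul rdiv_src.
by rewrite -rmul_lmul rdiv_rmul (negPf ne).
Qed.

Definition trivial_path i : qpath Q := @mkpath m Q i [::] isT isT.

Definition trivial_coef i x : k^o := x (trivial_path i).
Fact trivial_coef_linear i : linear (trivial_coef i).
Proof. by move=> c x y; rewrite /trivial_coef !ffunE. Qed.
HB.instance Definition _ i := GRing.isLinear.Build k _ _ _ _ (trivial_coef_linear i).

Definition augmentation i : 'Hom(regular k Q, simple_mod k Q i) :=
  (linfun (trivial_coef i) : 'Hom(kQ, k^o)).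

Lemma augmentationE i x : augmentation i x = x (trivial_path i).
Proof. by rewrite lfunE. Qed.

Lemma augmentation_hom i : augmentation i \in homs (regular k Q) (simple_mod k Q i).
Proof.
apply/homsP; split=> [j|a]; apply/lfunP => x; rewrite comp_lfunE [RHS]comp_lfunE.
  rewrite !augmentationE lfunE /= pvertex_mul ffunE eq_sym.
  by case: eqP => _; rewrite ?id_lfunE ?zero_lfunE // augmentationE.
rewrite zero_lfunE augmentationE lfunE /= ffunE big1 // => -[p1 p2] /= /and3P[_ _ /eqP].
by rewrite ffunE; case: (parrows p1) => //= _; rewrite mul0r.
Qed.

Lemma augmentation_onto i : limg (augmentation i) = fullv.
Proof.
apply/eqP; rewrite eqEsubv subvf; apply/subvP => c _.
apply/memv_imgP; exists ((c : k) *: (pvertex k Q i : kQ)); rewrite ?memvf //.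
by rewrite augmentationE !ffunE /= !eqxx; apply/esym/mulr1.
Qed.
End PathDivision.

(** * Injectivity of the Nakayama image of a projective *)

Section ArrowLifting.
Variables (k : finFieldType) (m : nat) (Q : quiver m).
Hypothesis Q_acyclic : acyclic_quiver Q.
Implicit Types M N P X : kmod k Q.

(** A concrete form of injectivity: the map from the component at [t] to the
    product of the components at the sources of the arrows ending at [t] is
    onto.  Unlike the lifting property of injectives, it obviously passes to
    quotients. *)
Definition arrow_lifting N : Prop := forall (t : 'I_m) (y : arr Q -> N),
  (forall a, tgt a = t -> idem N (src a) (y a) = y a) ->
  exists2 z, idem N t z = z & forall a, tgt a = t -> act N a z = y a.

Lemma arrow_lifting_quotient N X (p : 'Hom(N, X)) :
  p \in homs N X -> limg p = fullv -> arrow_lifting N -> arrow_lifting X.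
Proof.
move=> pH p_onto liftN t y yE.
have pK x : p ((p^-1)%VF x) = x by rewrite limg_lfunVK // p_onto memvf.
have [a _|z zt za] := liftN t (fun a => idem N (src a) ((p^-1)%VF (y a))).
  by rewrite idemE eqxx.
exists (p z) => [|a ta]; first by rewrite -(hom_idem _ _ pH) zt.
by rewrite -(hom_act _ _ pH) za // (hom_idem _ _ pH) pK yE.
Qed.

(** The component at [t] of the socle is the kernel of the map that
    [arrow_lifting] asserts to be onto. *)
Lemma dim_socle_lifting N : arrow_lifting N ->
  dim_vec (socle N) = euler_mx k Q *m dim_mod N.
Proof.
move=> liftN; apply/matrixP => t l; rewrite (ord1 l) euler_mx_mulE mxE.
pose F (z : N) : {ffun arr Q -> N} := [ffun a => if tgt a == t then act N a z else 0].
have F_lin : linear F.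
  move=> c x y; apply/ffunP => a; rewrite !ffunE; case: eqP => _; first exact: linearP.
  by rewrite scaler0 addr0.
pose f := linfun (HB.pack_for {linear N -> {ffun arr Q -> N}} F
  (GRing.isLinear.Build k _ _ _ _ F_lin)).
have fE z a : f z a = if tgt a == t then act N a z else 0 by rewrite lfunE /= ffunE.
have := limg_ker_dim f (limg (idem N t)).
rewrite (@dimv_ffun _ _ _ (f @: _)%VS
   (fun a => if tgt a == t then limg (idem N (src a)) else 0%VS)); last first.
  move=> y; apply/idP/forallP => [/memv_imgP[z _ ->] a|yU].
    rewrite fE; case: eqP => _; last exact: mem0v.
    by rewrite -idem_act memv_img ?memvf.
  have [a ta|z zt za] := liftN t y.
    have := yU a; rewrite ta eqxx memv_idem; last exact: idem_idem.
    by move/eqP.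
  have -> : y = f z.
    apply/ffunP => a; rewrite fE; case: eqP => [/za //|/eqP ta].
    by have := yU a; rewrite (negPf ta) memv0 => /eqP.
  by rewrite memv_img // -zt memv_img ?memvf.
have -> : (limg (idem N t) :&: lker f)%VS = (idem N t @: socle N)%VS.
  apply/vspaceP => x; rewrite memv_cap memv_ker mem_idem_socle // memv_idem ?idem_idem //.
  apply: andb_id2l => /eqP xt; apply/eqP/forallP => [/ffunP fx a|xa].
    case: (eqVneq (tgt a) t) => [ta|ne]; last first.
      by rewrite -xt -act_tgt idemE (negPf ne) linear0.
    by have := fx a; rewrite fE ta eqxx ffunE => ->.
  by apply/ffunP => a; rewrite fE ffunE (eqP (xa a)) if_same.
rewrite /vdim => <-; rewrite PoszD (big_morph Posz PoszD (erefl _)).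
rewrite [in X in _ - X]big_mkcond -addrA -sumrB big1 ?addr0 // => a _.
by case: ifP => _; rewrite ?dimv0 subrr.
Qed.

Section Nakayama.
Variables (P : kmod k Q) (P_proj : projective P).
Local Notation H := (homs P (regular k Q)).
Local Notation kQ := (pathalg k Q).

Lemma rdiv_hom (h : 'Hom(P, regular k Q)) a : h \in H ->
  (forall x, trivial_free (h x)) -> (rdiv k a \o h)%VF \in H.
Proof.
move=> hH h0; apply/homsP; split=> [i|b]; apply/lfunP => x;
  rewrite !comp_lfunE.
  rewrite (hom_idem _ _ hH) [idem (regular k Q) i (h x)]lfunE [RHS]lfunE.
  exact: rdiv_lmul.
rewrite (hom_act _ _ hH) [act (regular k Q) b (h x)]lfunE [RHS]lfunE.
exact: rdiv_lmul.
Qed.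

Lemma nakayama_actE a (xi : nakayama P) h :
  act (nakayama P) a xi h = xi (right_act (parrow k a) h).
Proof. exact: dual_actE. Qed.

Lemma nakayama_idemE i (xi : nakayama P) h :
  idem (nakayama P) i xi h = xi (right_act (pvertex k Q i) h).
Proof. exact: dual_actE. Qed.

(** Dually to the decomposition of the radical, linear forms prescribed on the
    subspaces [H a] of [H = Hom(P, kQ)], for the arrows [a] ending at [t], glue to
    a linear form on [H]: divide by each [a] and sum up. *)
Lemma nakayama_lifting : arrow_lifting (nakayama P).
Proof.
move=> t y yE.
pose post (a : arr Q) : 'End('Hom(P, kQ)) := linfun (sandwich \1%VF (rdiv k a)).
pose xi : nakayama P := \sum_(a | tgt a == t)
  (y a \o linfun (vsproj H) \o post a \o linfun vsval)%VF.
exists (idem (nakayama P) t xi) => [|a ta]; first by rewrite idemE eqxx.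
apply/lfunP => x; rewrite nakayama_actE nakayama_idemE right_actM -ta arrow_pvertex.
rewrite /xi sum_lfunE (bigD1 a) ?ta //= big1 ?addr0 => [|b /andP[_ ne]];
  rewrite !comp_lfunE !lfunE /= /sandwich comp_lfun1r val_right_act comp_lfunA.
  rewrite -[in RHS](yE a ta) nakayama_idemE; congr (y a _).
  rewrite /right_act; congr (vsproj _ _); apply/lfunP => z.
  by rewrite !comp_lfunE rdiv_rmul // eqxx.
rewrite [X in vsproj _ X](_ : _ = 0) ?linear0 //; apply/lfunP => z.
by rewrite !comp_lfunE rdiv_rmul // eq_sym (negPf ne) !zero_lfunE.
Qed.

(** The socle at [t] consists of the linear forms on [Hom(P, kQ)] that vanish on
    the maps whose composite with the augmentation to the simple module at [t] is
    zero.  Projectivity of [P] makes every map to this simple module such a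
    composite, so the socle at [t] is dual to [Hom(P, S_t)]. *)
Lemma dim_socle_nakayama : dim_vec (socle (nakayama P)) = dim_top P.
Proof.
apply/matrixP => t l; rewrite (ord1 l) -hom_dim_simple // mxE; congr Posz.
pose S := simple_mod k Q t.
have augH : augmentation k Q t \in homs (regular k Q) S by apply: augmentation_hom.
pose F (h : subvs_of H) : 'Hom(P, S) := (augmentation k Q t \o vsval h)%VF.
have F_lin : linear F.
  by move=> c x y; rewrite /F linearP /= comp_lfunDr -comp_lfunZr.
pose f := linfun (HB.pack_for {linear subvs_of H -> 'Hom(P, S)} F
  (GRing.isLinear.Build k _ _ _ _ F_lin)).
have fE h x : f h x = (vsval h x : kQ) (trivial_path Q t).
  by rewrite lfunE /= /F comp_lfunE augmentationE.
have rmul_t (h : subvs_of H) i x :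
    (vsval (right_act (pvertex k Q i) h) x : kQ) (trivial_path Q t) =
    if t == i then (vsval h x : kQ) (trivial_path Q t) else 0.
  by rewrite val_right_act comp_lfunE lfunE /= /rmul_fun mul_pvertex ffunE.
have aug_arrow (h : subvs_of H) a : right_act (parrow k a) h \in lker f.
  rewrite memv_ker; apply/eqP/lfunP => x.
  rewrite fE zero_lfunE val_right_act comp_lfunE rmul_arrowE //.
  by rewrite big1 // => r /and3P[_ _]; case: (parrows r).
(* Right multiplication by the vertex [t] kills the coefficients at the trivial
   paths of the other vertices, and membership in the kernel kills the last one. *)
have trivial_free_ker h x : h \in lker f ->
    trivial_free (vsval (right_act (pvertex k Q t) h) x : kQ).
  rewrite memv_ker => /eqP fh p p0; have -> : p = trivial_path Q (pstart p) by apply: qpath_inj.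
  rewrite val_right_act comp_lfunE lfunE /= /rmul_fun mul_pvertex ffunE.
  case: eqP => // e; have -> : pstart p = t by [].
  by rewrite -fE fh zero_lfunE.
have ker_split h : h \in lker f -> right_act (pvertex k Q t) h =
    \sum_a right_act (parrow k a) (vsproj H (rdiv k a \o vsval (right_act (pvertex k Q t) h))%VF).
  move=> hK; apply: subvs_inj; rewrite linear_sum /=; apply/lfunP => x.
  rewrite sum_lfunE -[LHS](rmul_rdiv_sum Q_acyclic (trivial_free_ker h x hK)).
  apply: eq_bigr => a _.
  pose g : 'Hom(P, regular k Q) := (rdiv k a \o vsval (right_act (pvertex k Q t) h))%VF.
  have gH : g \in H.
    by apply: rdiv_hom; [exact: subvsP | move=> y; exact: trivial_free_ker].
  by rewrite (val_right_act (parrow k a)) (vsprojK gH) comp_lfunE comp_lfunE.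
have socE : forall xi, (xi \in (idem (nakayama P) t @: socle (nakayama P))%VS) =
    (lker f <= lker xi)%VS.
  move=> xi; rewrite mem_idem_socle //; apply/andP/subvP => [[/eqP xt /forallP xa] h hK|sub].
    rewrite memv_ker -xt nakayama_idemE ker_split // linear_sum big1 //= => a _.
    by rewrite -nakayama_actE (eqP (xa a)) zero_lfunE.
  split; last first.
    apply/forallP => a; apply/eqP/lfunP => h.
    by rewrite nakayama_actE zero_lfunE; apply/eqP; rewrite -memv_ker sub.
  apply/eqP/lfunP => h; rewrite nakayama_idemE; apply/eqP; rewrite -subr_eq0 -linearB -memv_ker.
  apply: sub; rewrite memv_ker; apply/eqP/lfunP => x.
  by rewrite linearB add_lfunE opp_lfunE !fE rmul_t eqxx subrr zero_lfunE.
rewrite (dim_annihilator socE) [\dim {:k^o}]dimvf muln1.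
have := limg_ker_dim f fullv; rewrite capfv => <-; rewrite addKn.
congr (\dim _); apply/vspaceP => g; apply/memv_imgP/idP => [[h _ ->]|gH].
  have hH := subvsP h; rewrite lfunE /= /F; exact: homs_comp hH augH.
have [h hH hg] := P_proj augH (augmentation_onto k Q t) gH.
by exists (vsproj H h); rewrite ?memvf // lfunE /= /F vsprojK.
Qed.
End Nakayama.
End ArrowLifting.

(** * The multiplication formula for sums over submodules *)

Section DotProduct.
Variable m : nat.
Implicit Types x y z : 'cV[int]_m.

Definition dot x y : int := (x^T *m y) 0 0.

Lemma dotE x y : dot x y = \sum_i x i 0 * y i 0.
Proof. by rewrite /dot mxE; apply: eq_bigr => i _; rewrite mxE. Qed.

Lemma dotC x y : dot x y = dot y x.
Proof. by rewrite !dotE; apply: eq_bigr => i _; rewrite mulrC. Qed.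

Lemma dotDr x y z : dot x (y + z) = dot x y + dot x z.
Proof. by rewrite /dot mulmxDr mxE. Qed.

Lemma dotBr x y z : dot x (y - z) = dot x y - dot x z.
Proof. by rewrite /dot mulmxBr !mxE. Qed.

Lemma dotDl x y z : dot (x + y) z = dot x z + dot y z.
Proof. by rewrite ![dot _ z]dotC dotDr. Qed.

Lemma dotBl x y z : dot (x - y) z = dot x z - dot y z.
Proof. by rewrite ![dot _ z]dotC dotBr. Qed.

Lemma dot_mulmx (A : 'M[int]_m) x y : dot x (A *m y) = dot (A^T *m x) y.
Proof. by rewrite /dot trmx_mul trmxK mulmxA. Qed.

Lemma ler_dot x y z : (forall i, 0 <= x i 0) -> (forall i, y i 0 <= z i 0) ->
  dot x y <= dot x z.
Proof. by move=> x0 yz; rewrite !dotE ler_sum // => i _; rewrite ler_wpM2l. Qed.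

Lemma dot_ge0 x y : (forall i, 0 <= x i 0) -> (forall i, 0 <= y i 0) -> 0 <= dot x y.
Proof. by move=> x0 y0; rewrite dotE sumr_ge0 // => i _; rewrite mulr_ge0. Qed.

Lemma dot_gt0 x y i : (forall i, 0 <= x i 0) -> (forall i, 0 <= y i 0) ->
  0 < x i 0 -> 0 < y i 0 -> 0 < dot x y.
Proof.
move=> x0 y0 xi yi; rewrite dotE (bigD1 i) //= ltr_pwDl ?mulr_gt0 //.
by rewrite sumr_ge0 // => j _; rewrite mulr_ge0.
Qed.
End DotProduct.

Section Multiplication.
Variables (k : finFieldType) (m : nat) (Q : quiver m) (Q_acyclic : acyclic_quiver Q).
Variable L : 'M[int]_m.
Local Notation E := (euler_mx k Q).

Lemma euler_form_dot x y : euler_form k Q x y = dot x (E *m y).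
Proof. by rewrite euler_formE /dot mulmxA. Qed.

Lemma qX_mulZ x y a :
  qX k L x * (qhalf k a *: qX k L y) = qhalf k (a + lam L x y) *: qX k L (x + y).
Proof. by rewrite -scalerAr qXM scalerA qhalfD. Qed.

Lemma eq_scale_qX a b x y :
  a = b -> x = y -> qhalf k a *: qX k L x = qhalf k b *: qX k L y.
Proof. by move=> -> ->. Qed.

(** The Caldero-Chapoton sum with one term per submodule and a shift [s] of all
    exponents.  Working with modules over the whole quiver and with [s] in place of
    a projective summand makes the formula below independent of the embedding of
    the full subquiver. *)
Definition submod_char (N : kmod k Q) (s : 'cV[int]_m) : qtorus k L :=
  \sum_(U : {vspace N} | submodule U)
    qhalf k (- euler_form k Q (dim_vec U) (dim_mod N - dim_vec U)) *:
      qX k L (s - E^T *m dim_vec U - E *m (dim_mod N - dim_vec U)).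

Variables (M P : kmod k Q) (P_proj : projective P) (PM1 : hom_dim P M = 1%N).
Variables (f : 'Hom(P, M)) (f_hom : f \in homs P M) (f_neq0 : f != 0).
Variables (g : 'Hom(M, nakayama P)) (g_hom : g \in homs M (nakayama P)) (g_neq0 : g != 0).
Variables (P' A : kmod k Q) (i1 : 'Hom(P', P)) (p1 : 'Hom(M, A)).
Hypotheses (i1_hom : i1 \in homs P' P) (p1_hom : p1 \in homs M A).
Hypothesis f_exact : exact4 i1 f p1.
Variables (B I' : kmod k Q) (i2 : 'Hom(B, M)) (p2 : 'Hom(nakayama P, I')).
Hypotheses (i2_hom : i2 \in homs B M) (p2_hom : p2 \in homs (nakayama P) I').
Hypothesis g_exact : exact4 i2 g p2.
Hypotheses (BI0 : hom_dim B I' = 0%N) (PA0 : hom_dim P' A = 0%N).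
Hypothesis L_compat : forall U : {vspace M}, submodule U ->
  L *m ((E - E^T) *m dim_vec U) = - dim_vec U.

Local Notation t := (dim_top P).

Let t_ge0 i : 0 <= t i 0.
Proof. by rewrite -hom_dim_simple. Qed.

Lemma hom_dim_projective (X N : kmod k Q) : (forall N, ext_vanishes X N) ->
  (hom_dim X N)%:Z = dot (dim_top X) (dim_mod N).
Proof. by move=> eX; rewrite hom_dim_euler // euler_top. Qed.

Let homP N : (hom_dim P N)%:Z = dot t (dim_mod N).
Proof. by apply: hom_dim_projective => X; apply: projective_ext. Qed.

Let extP' N : ext_vanishes P' N.
Proof.
have [ki _ _ _] := f_exact.
exact: ext_vanishes_sub i1_hom ki (projective_ext N P_proj).
Qed.

Let dim_mod_ge0 (N : kmod k Q) i : 0 <= dim_mod N i 0.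
Proof. exact: dim_vec_ge0. Qed.

Let tM : dot t (dim_mod M) = 1.
Proof. by rewrite -homP PM1. Qed.

Let homsPM (h : 'Hom(P, M)) : h \in homs P M -> h != 0 -> homs P M = <[h]>%VS.
Proof.
move=> hH h0; apply/esym/eqP; rewrite eqEdim -memvE hH dim_vline h0.
by rewrite /= -PM1.
Qed.

(** A map from [P] to [A] lifts to [M], where it is a multiple of [f], which dies
    in [A]. *)
Let tA : dot t (dim_mod A) = 0.
Proof.
have [_ _ fp1 p1_onto] := f_exact.
rewrite -homP /hom_dim (_ : homs P A = 0%VS) ?dimv0 //.
apply/eqP; rewrite -subv0; apply/subvP => h hH; rewrite memv0.
have [h' h'H <-] := P_proj p1_hom p1_onto hH.
move: h'H; rewrite (homsPM f_hom f_neq0) => /vlineP[c ->].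
apply/eqP/lfunP => x; rewrite comp_lfunE scale_lfunE linearZ zero_lfunE /=.
have : f x \in lker p1 by rewrite -fp1 memv_img ?memvf.
by rewrite memv_ker => /eqP ->; rewrite scaler0.
Qed.

Let topP'A : dot (dim_top P') (dim_mod A) = 0.
Proof. by rewrite -hom_dim_projective // PA0. Qed.

Let I'_lift : arrow_lifting I'.
Proof.
have [_ _ _ p2_onto] := g_exact.
exact: arrow_lifting_quotient p2_hom p2_onto (nakayama_lifting Q_acyclic (P := P)).
Qed.

Local Notation s := (dim_vec (socle I')).

Let socI' : s = E *m dim_mod I'.
Proof. exact: dim_socle_lifting. Qed.

Let socI : t = E *m dim_mod (nakayama P).
Proof.
rewrite -dim_socle_lifting //; last exact: nakayama_lifting.
by rewrite dim_socle_nakayama.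
Qed.

(** This is the value of the Euler form on [(B, I')]; it is nonnegative as a product
    of dimension vectors and at most the dimension of [Hom(B, I') = 0]. *)
Let Bs : dot (dim_mod B) s = 0.
Proof.
apply/eqP; rewrite eq_le dot_ge0 //; last by move=> i; exact: dim_vec_ge0.
rewrite andbT socI' -euler_form_dot -euler_euler_form.
by have := euler_hom_dim B I'; rewrite BI0.
Qed.

Local Notation dK := (dim_vec (limg f)).
Local Notation dG := (dim_vec (limg g)).

Let dimM_f : dim_mod M = dK + dim_mod A.
Proof.
have [_ _ -> p1_onto] := f_exact.
by rewrite [LHS](dim_vec_ker_img p1_hom (submodule_full M)) capfv p1_onto.
Qed.

Let ETdK : E^T *m dK = t - dim_top P'.
Proof.
have [ki i1f _ _] := f_exact.
have dP : dim_mod P = dim_mod P' + dK.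
  rewrite [LHS](dim_vec_ker_img f_hom (submodule_full P)) capfv -i1f.
  congr (_ + _); rewrite [RHS](dim_vec_ker_img i1_hom (submodule_full P')).
  by rewrite ki capv0 dim_vec0 add0r.
rewrite (dim_top_euler Q_acyclic (fun N => projective_ext N P_proj)).
by rewrite (dim_top_euler Q_acyclic extP') -mulmxBr dP addrAC subrr add0r.
Qed.

Let dimB : dim_vec (lker g) = dim_mod B.
Proof.
have [ki i2g _ _] := g_exact.
rewrite -i2g [RHS](dim_vec_ker_img i2_hom (submodule_full B)).
by rewrite ki capv0 dim_vec0 add0r.
Qed.

Let dimM_g : dim_mod M = dim_mod B + dG.
Proof. by rewrite [LHS](dim_vec_ker_img g_hom (submodule_full M)) capfv dimB. Qed.

Let EdG : E *m dG = t - s.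
Proof.
have [_ _ gp2 p2_onto] := g_exact.
rewrite socI socI' -mulmxBr; congr (_ *m _).
rewrite [X in X - _](dim_vec_ker_img p2_hom (submodule_full _)) capfv -gp2 p2_onto.
by rewrite addrK.
Qed.

(** A nonzero submodule meets the socle, and [t] is the dimension vector of the
    socle. *)
Let dot_nakayama_gt0 (W : {vspace nakayama P}) : submodule W -> W != 0%VS ->
  0 < dot t (dim_vec W).
Proof.
move=> sW W0; have [i [y [yW y0 yi ya]]] := submodule_socle_vector Q_acyclic sW W0.
have pos (V : {vspace nakayama P}) : y \in V -> 0 < dim_vec V i 0.
  move=> yV; rewrite mxE ltz_nat lt0n dimv_eq0; apply: contraNneq y0 => V0.
  by rewrite -memv0 -V0 -yi memv_img.
apply: (@dot_gt0 _ _ _ i) => //; [by move=> j; apply: dim_vec_ge0 | | exact: pos].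
by rewrite -dim_socle_nakayama // pos // (mem_socle yi).
Qed.

Let dotU_gt0 (U : {vspace M}) : submodule U -> ~~ (U <= lker g)%VS -> 0 < dot t (dim_vec U).
Proof.
move=> sU; rewrite lkerE => gU; rewrite (dim_vec_ker_img g_hom sU) dotDr.
rewrite ltr_wpDl ?dot_nakayama_gt0 ?(submodule_img g_hom) // dot_ge0 // => i.
exact: dim_vec_ge0.
Qed.

Let dotU_le (U W : {vspace M}) : (U <= W)%VS -> dot t (dim_vec U) <= dot t (dim_vec W).
Proof. by move=> UW; apply: ler_dot => // i; apply: dim_vecS. Qed.

(** The value [t.m = 1] is shared between [B] and the image of [g], and the latter
    takes at least one. *)
Let tB : dot t (dim_mod B) = 0.
Proof.
apply/eqP; rewrite eq_le dot_ge0 // andbT.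
have : 0 < dot t dG.
  apply: dot_nakayama_gt0; first exact: submodule_img g_hom (submodule_full M).
  apply: contra g_neq0 => /eqP g0; apply/eqP/lfunP => x.
  by apply/eqP; rewrite zero_lfunE -memv0 -g0 memv_img ?memvf.
have := tM; rewrite dimM_g dotDr => tBG; rewrite gtz0_ge1.
by rewrite -[X in X <= _]tBG gerDr.
Qed.

Let dot_sub_B (U : {vspace M}) : (U <= lker g)%VS -> dot t (dim_vec U) = 0.
Proof.
move=> /dotU_le; rewrite dimB tB => le0; apply/eqP; rewrite eq_le le0 dot_ge0 // => i.
exact: dim_vec_ge0.
Qed.

Let dot_sub_B_socle (U : {vspace M}) : (U <= lker g)%VS -> dot (dim_vec U) s = 0.
Proof.
move=> sUB; apply/eqP; rewrite eq_le dot_ge0 ?andbT; try by move=> i; apply: dim_vec_ge0.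
rewrite -Bs dotC [X in _ <= X]dotC; apply: ler_dot => i; first exact: dim_vec_ge0.
by rewrite -dimB dim_vecS.
Qed.

(** If [U] is not in [ker g], then [Hom(P, U)] is nonzero, and since [Hom(P, M)] is
    a line, [f] factors through [U]. *)
Let img_sub (U : {vspace M}) : submodule U -> ~~ (U <= lker g)%VS -> (limg f <= U)%VS.
Proof.
move=> sU /(dotU_gt0 sU); rewrite -(dim_mod_submod sU) -homP => gt0.
have H0 : homs P (submod sU) != 0%VS by rewrite -dimv_eq0 -lt0n.
pose h : 'Hom(P, submod sU) := vpick (homs P (submod sU)).
have hH : h \in homs P (submod sU) by apply: memv_pick.
have h0 : h != 0 by rewrite vpick0.
have ihH := homs_comp hH (submod_incl_hom sU).
have ih0 : (submod_incl sU \o h)%VF != 0.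
  apply: contra h0 => /eqP ih0; apply/eqP/lfunP => x; rewrite zero_lfunE.
  apply/eqP; rewrite -memv0 -(submod_incl_ker sU) memv_ker -comp_lfunE ih0.
  by rewrite zero_lfunE.
have : f \in homs P M := f_hom; rewrite (homsPM ihH ih0) => /vlineP[c ->].
apply/subvP => _ /memv_imgP[x _ ->]; rewrite scale_lfunE comp_lfunE memvZ //.
by have := memv_img (submod_incl sU) (memvf (h x)); rewrite submod_incl_img.
Qed.

Let tK : dot t dK = 1.
Proof. by have := tM; rewrite dimM_f dotDr tA addr0. Qed.

Let dot_sup_img (U : {vspace M}) : (limg f <= U)%VS -> dot t (dim_vec U) = 1.
Proof.
move=> fU; apply/eqP; rewrite eq_le -{1}tM -tK; apply/andP; split; apply: dotU_le => //.
exact: subvf.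
Qed.

Let sub_ker_img (U : {vspace M}) : submodule U -> (U <= lker g)%VS = ~~ (limg f <= U)%VS.
Proof.
move=> sU; apply/idP/idP => [Ug|]; last by apply: contraR; apply: img_sub.
apply/negP => /dot_sup_img; rewrite dot_sub_B //.
Qed.

Local Notation c := (lam L t (- (E *m dim_mod M))).
Local Notation eform := (euler_form k Q).

(** Commuting [X^t] past the term of [U] costs [t.u], by the compatibility of [L]
    with the antisymmetrized Euler form. *)
Let mul_char : qX k L t * submod_char M 0 =
  \sum_(U : {vspace M} | submodule U)
    qhalf k (c - dot t (dim_vec U) - eform (dim_vec U) (dim_mod M - dim_vec U)) *:
    qX k L (t - E^T *m dim_vec U - E *m (dim_mod M - dim_vec U)).
Proof.
rewrite /submod_char mulr_sumr; apply: eq_bigr => U sU.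
rewrite qX_mulZ; apply: eq_scale_qX; last by rewrite sub0r !addrA.
rewrite addrC; congr (_ + _).
have -> : 0 - E^T *m dim_vec U - E *m (dim_mod M - dim_vec U) =
    - (E *m dim_mod M) + (E - E^T) *m dim_vec U.
  rewrite mulmxBr mulmxBl; move: (E *m _) (E *m _) (_ *m _) => x y z.
  by apply/matrixP => i j; rewrite !mxE; ring.
rewrite lamDr; congr (_ + _); rewrite /lam -mulmxA L_compat //.
by rewrite mulmxN mxE.
Qed.

(** Replacing [M] by [B] changes the Euler exponent by the value on [U] and the
    image of [g], which is [t.u - u.s]; both terms vanish. *)
Let part_B :
  \sum_(U : {vspace M} | submodule U && (U <= lker g)%VS)
    qhalf k (c - dot t (dim_vec U) - eform (dim_vec U) (dim_mod M - dim_vec U)) *: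
    qX k L (t - E^T *m dim_vec U - E *m (dim_mod M - dim_vec U)) =
  qhalf k c *: submod_char B s.
Proof.
have [ki i2g _ _] := g_exact.
have inj_i2 : lker i2 == 0%VS by apply/eqP.
have i2K (W : {vspace B}) : (i2 @^-1: (i2 @: W))%VS = W.
  apply/eqP; rewrite -(eq_limg_ker0 _ _ inj_i2) lpreimK //.
  by rewrite limgS ?subvf.
rewrite /submod_char scaler_sumr.
rewrite (reindex_onto (fun W : {vspace B} => (i2 @: W)%VS)
  (fun U : {vspace M} => (i2 @^-1: U)%VS)) /=; last first.
  by move=> U /andP[_ Ug]; rewrite lpreimK // i2g.
apply: eq_big => [W|W /andP[/andP[sW Wg] _]].
  rewrite i2K eqxx andbT -i2g limgS ?subvf // andbT.
  apply/idP/idP => [sW|]; last exact: submodule_img.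
  by rewrite -(i2K W); apply: submodule_preim.
have sW' : submodule W by rewrite -(i2K W); apply: submodule_preim.
have dW : dim_vec (i2 @: W)%VS = dim_vec W.
  by rewrite [RHS](dim_vec_ker_img i2_hom sW') ki capv0 dim_vec0 add0r.
have tW := dot_sub_B Wg; have sWs := dot_sub_B_socle Wg.
rewrite scalerA -qhalfD tW subr0; rewrite dW in tW sWs *.
have -> : dim_mod M - dim_vec W = dim_mod B - dim_vec W + dG.
  by rewrite dimM_g addrAC.
apply: eq_scale_qX; [congr (_ - _) |].
  by rewrite !euler_form_dot mulmxDr dotDr EdG dotBr [dot _ t]dotC tW sWs subrr addr0.
rewrite mulmxDr EdG; move: (E *m _) (_ *m _) => x y.
by apply/matrixP => i j; rewrite !mxE; ring.
Qed.

(** Here [U] is the preimage of [W], and the change of the Euler exponent is its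
    value on the image of [f] and [A / W], which vanishes by orthogonality to both
    [t] and the top of [P']. *)
Let part_A :
  \sum_(U : {vspace M} | submodule U && ~~ (U <= lker g)%VS)
    qhalf k (c - dot t (dim_vec U) - eform (dim_vec U) (dim_mod M - dim_vec U)) *:
    qX k L (t - E^T *m dim_vec U - E *m (dim_mod M - dim_vec U)) =
  qhalf k (c - 1) *: submod_char A (dim_top P').
Proof.
have [_ _ fp1 p1_onto] := f_exact.
have p1K (W : {vspace A}) : (p1 @: (p1 @^-1: W))%VS = W.
  by rewrite lpreimK // p1_onto subvf.
have p1KU (U : {vspace M}) : (limg f <= U)%VS -> (p1 @^-1: (p1 @: U))%VS = U.
  move=> fU; apply/vspaceP => x; rewrite -memv_preim.
  apply/memv_imgP/idP => [[u uU pxu]|xU]; last by exists x.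
  rewrite -(subrK u x) memvD // (subvP fU) // fp1 memv_ker linearB /= pxu.
  by rewrite subrr.
have fpre (W : {vspace A}) : (limg f <= p1 @^-1: W)%VS.
  by rewrite fp1 -lpreim0 lpreimS // sub0v.
rewrite /submod_char scaler_sumr.
rewrite (reindex_onto (fun W : {vspace A} => (p1 @^-1: W)%VS)
  (fun U : {vspace M} => (p1 @: U)%VS)) /=; last first.
  by move=> U /andP[sU Ug]; rewrite p1KU // img_sub.
have sub_pre (W : {vspace A}) : submodule (p1 @^-1: W)%VS = submodule W.
  apply/idP/idP => [sW|]; last exact: submodule_preim.
  by rewrite -(p1K W); apply: submodule_img.
apply: eq_big => [W|W /andP[/andP[sW _] _]].
  rewrite p1K eqxx andbT sub_pre; case sW : (submodule W) => //=.
  by rewrite sub_ker_img ?sub_pre // fpre.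
have dW : dim_vec (p1 @^-1: W)%VS = dK + dim_vec W.
  rewrite (dim_vec_ker_img p1_hom sW) p1K; congr (_ + _).
  by congr dim_vec; rewrite -fp1; apply/capv_idPr; rewrite fpre.
have -> : dim_mod M - dim_vec (p1 @^-1: W)%VS = dim_mod A - dim_vec W.
  by rewrite dimM_f dW opprD addrACA subrr add0r.
rewrite scalerA -qhalfD (dot_sup_img (fpre W)) dW.
have orth (x : 'cV[int]_m) : (forall i, 0 <= x i 0) -> dot x (dim_mod A) = 0 ->
    dot x (dim_mod A - dim_vec W) = 0.
  move=> x0 xA; have : dot x (dim_vec W) <= 0.
    by rewrite -xA; apply: ler_dot => // i; apply: dim_vecS; apply: subvf.
  rewrite dotBr xA sub0r => le0; apply/eqP; rewrite oppr_eq0 eq_le le0 dot_ge0 // => i.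
  exact: dim_vec_ge0.
apply: eq_scale_qX; [congr (_ - _) |].
  rewrite !euler_form_dot !dot_mulmx mulmxDr ETdK dotDl dotBl.
  by rewrite (orth t) // (orth (dim_top P')) ?subrr ?add0r // => i; rewrite -hom_dim_simple.
rewrite mulmxDr ETdK; move: (E *m _) (_ *m dim_vec W) => x y.
by apply/matrixP => i j; rewrite !mxE; ring.
Qed.

Theorem submod_char_mul : qX k L t * submod_char M 0 =
  qhalf k c *: submod_char B s + qhalf k (c - 1) *: submod_char A (dim_top P').
Proof. by rewrite mul_char (bigID (fun U => U <= lker g)%VS) /= part_B part_A. Qed.
End Multiplication.

(** * Modules over the full subquiver *)

Section Inflation.
Variables (k : finFieldType) (n m : nat) (le_nm : (n <= m)%N) (Q : quiver m).
Local Notation E := (euler_mx k Q).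
Local Notation I := (Itilde n m).

Lemma mul_Itilde p (A : 'M[int]_(p, m)) i j : (A *m I) i j = A i (widen_ord le_nm j).
Proof.
rewrite mxE (bigD1 (widen_ord le_nm j)) //= mxE /= eqxx ltn_ord mulr1.
rewrite big1 ?addr0 // => l ne; rewrite mxE.
by case: eqP => [lj|]; rewrite ?mulr0 //; case/eqP: ne; apply: val_inj.
Qed.

Lemma Itilde_mul (x : 'cV[int]_n) i : (I *m x) i 0 = oapp (fun j => x j 0) 0 (insub (i : nat)).
Proof.
rewrite mxE; case: insubP => [j _ ji|ni] /=.
  rewrite (bigD1 j) //= mxE -ji eqxx ltn_ord mul1r big1 ?addr0 // => l ne.
  by rewrite mxE -ji eq_sym (inj_eq val_inj) (negPf ne) mul0r.
rewrite big1 // => l _; rewrite mxE; case: eqP => [il|]; rewrite ?mul0r //.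
by rewrite il ltn_ord in ni.
Qed.

Lemma Rtilde_euler : I - Rtilde k le_nm Q = E *m I.
Proof.
apply/matrixP => i j; rewrite mul_Itilde euler_mxE !mxE ext1_dim_simple.
congr (_ - _).
  by rewrite -val_eqE /=; case: eqP => // ->; rewrite ltn_ord.
by rewrite -sum1_card (big_morph Posz PoszD (erefl _)) big_mkcond;
  apply: eq_bigr => a _; rewrite inE; case: ifP.
Qed.

Lemma Btilde_euler : Btilde le_nm Q = (E - E^T) *m I.
Proof.
have card_sum (i j : 'I_m) : #|[set a : arr Q | (src a == i) && (tgt a == j)]|%:Z =
    \sum_(a : arr Q) ((src a == i) && (tgt a == j))%:R.
  by rewrite -sum1_card (big_morph Posz PoszD (erefl _)) big_mkcond;
    apply: eq_bigr => a _; rewrite inE; case: ifP.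
apply/matrixP => i j; rewrite mul_Itilde [LHS]mxE [RHS]mxE [(- E^T) _ _]mxE [E^T _ _]mxE.
by rewrite !euler_mxE !card_sum eq_sym; ring.
Qed.

Section Module.
Variable N : kmod k (full_sub n Q).
Local Notation Ni := (inflate le_nm N).

Lemma submodule_inflate (U : {vspace N}) : submodule (M := Ni) U = submodule U.
Proof.
apply/submoduleP/submoduleP => -[Hi Ha]; split=> [i|a] x xU.
- have := Hi (widen_ord le_nm i) x xU; rewrite /= /infl_idem.
  by rewrite (_ : insub _ = Some i) //=; apply: valK.
- have := Ha (val a) x xU; rewrite /= /infl_act.
  by rewrite (_ : insub _ = Some a) //=; apply: valK.
- rewrite /= /infl_idem; case: insub => [j|] /=; first exact: Hi.
  by rewrite zero_lfunE mem0v.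
rewrite /= /infl_act; case: insub => [b|] /=; first exact: Ha.
by rewrite zero_lfunE mem0v.
Qed.

Lemma dim_vec_inflate (U : {vspace N}) : dim_vec (M := Ni) U = I *m dim_vec U.
Proof.
apply/matrixP => i j; rewrite (ord1 j) Itilde_mul mxE /= /infl_idem.
case: insub => [l|] /=; first by rewrite mxE.
by rewrite lim0g dimv0.
Qed.

(** Grouping the submodules of [N] by dimension vector turns the cardinals of the
    quiver Grassmannians into sums of ones. *)
Lemma CC_submod_char (L : 'M[int]_m) (P : kmod k Q) :
  CC le_nm L N P = submod_char L Ni (dim_top P).
Proof.
rewrite /CC; set d := dim_vec (fullv : {vspace N}).
pose F (e : 'cV[int]_n) : qtorus k L :=
  qhalf k (- euler_form k Q (I *m e) (I *m (d - e))) *: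
    qX k L (Btilde le_nm Q *m e - (I - Rtilde k le_nm Q) *m d + dim_top P).
transitivity (\sum_(U : {vspace N} | submodule U) F (dim_vec U)).
  pose v (U : {vspace N}) : 'cV['I_(\dim (fullv : {vspace N})).+1]_n :=
    \col_i inord (\dim (idem N i @: U)).
  have vE U : map_mx (fun j : 'I__ => (j : nat)%:Z) (v U) = dim_vec U.
    apply/matrixP => i j; rewrite !mxE inordK // ltnS dimvS // subvf //.
  rewrite (partition_big v xpredT) //=; apply: eq_bigr => w _; set e := map_mx _ w.
  rewrite (eq_bigr (fun=> F e)); last by move=> U /andP[_ /eqP vw]; rewrite /e -vw vE.
  rewrite sumr_const -scaler_nat /F scalerA; congr (_ *: _).
  congr (_%:R * _); apply: eq_card => U; rewrite !inE; congr (_ && _).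
  rewrite /e -vE; apply/eqP/eqP => [/matrixP ew|->] //.
  by apply/matrixP => i j; apply: val_inj; have := ew i j; rewrite !mxE => -[].
apply: eq_big => [U|U sU]; first by rewrite submodule_inflate.
rewrite /F; have dmE : dim_mod Ni = I *m d by apply: dim_vec_inflate.
rewrite dim_vec_inflate dmE -mulmxBr; apply: eq_scale_qX => //.
rewrite Btilde_euler Rtilde_euler -!mulmxA mulmxBl !mulmxBr.
move: (E *m _) (E *m _) (_ *m (I *m dim_vec U)) => x y z.
by apply/matrixP => i j; rewrite !mxE; ring.
Qed.
End Module.

Lemma dim_top_zero_mod : dim_top (zero_mod k Q) = 0.
Proof.
have v0 (U : {vspace zero_mod k Q}) : U = 0%VS.
  by apply/eqP; rewrite -subv0; apply/subvP => x _; rewrite [x]thinmx0 mem0v.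
by rewrite /dim_top [fullv]v0 [radical _]v0 subrr.
Qed.
End Inflation.

Lemma dim_top_proj_of_inj (k : finFieldType) m (Q : quiver m) (J PJ : kmod k Q) :
  proj_of_inj J PJ -> dim_top PJ = dim_vec (socle J).
Proof.
case=> _ [h hH [kh ih]]; rewrite /dim_top.
by rewrite (dim_vec_ker_img hH (submodule_full PJ)) capfv kh ih addrAC subrr add0r.
Qed.

Theorem theorem3p8 (k : finFieldType) (n m : nat) (n_gt0 : (0 < n)%N)
    (le_nm : (n <= m)%N) (Q : quiver m) (Q_acyclic : acyclic_quiver Q)
    (L : 'M[int]_m) (L_skew : L^T = - L)
    (L_compat : L *m (- Btilde le_nm Q) = Itilde n m)
    (M : kmod k (full_sub n Q)) (P : kmod k Q) (P_proj : projective P)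
    (PM1 : hom_dim P (inflate le_nm M) = 1%N)
    (MI1 : hom_dim (inflate le_nm M) (nakayama P) = 1%N)
    (f : 'Hom(P, inflate le_nm M)) (f_hom : f \in homs P (inflate le_nm M))
    (f_neq0 : f != 0)
    (g : 'Hom(inflate le_nm M, nakayama P))
    (g_hom : g \in homs (inflate le_nm M) (nakayama P)) (g_neq0 : g != 0)
    (P' : kmod k Q) (A : kmod k (full_sub n Q))
    (i1 : 'Hom(P', P)) (p1 : 'Hom(inflate le_nm M, inflate le_nm A))
    (i1_hom : i1 \in homs P' P)
    (p1_hom : p1 \in homs (inflate le_nm M) (inflate le_nm A))
    (f_exact : exact4 i1 f p1)
    (B : kmod k (full_sub n Q)) (I' : kmod k Q)
    (i2 : 'Hom(inflate le_nm B, inflate le_nm M)) (p2 : 'Hom(nakayama P, I'))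
    (i2_hom : i2 \in homs (inflate le_nm B) (inflate le_nm M))
    (p2_hom : p2 \in homs (nakayama P) I')
    (g_exact : exact4 i2 g p2)
    (PI' : kmod k Q) (PI'_proj : proj_of_inj I' PI')
    (BI0 : hom_dim (inflate le_nm B) I' = 0%N)
    (PA0 : hom_dim P' (inflate le_nm A) = 0%N) :
  let dM := dim_vec (fullv : {vspace M}) in
  let c := lam L (dim_top P) (- ((Itilde n m - Rtilde k le_nm Q) *m dM)) in
  CC le_nm L (zero_mod k (full_sub n Q)) P * CC le_nm L M (zero_mod k Q) =
    qhalf k c *: CC le_nm L B PI' + qhalf k (c - 1) *: CC le_nm L A P'.
Proof.
move=> dM c.
rewrite CC_zero !CC_submod_char dim_top_zero_mod (dim_top_proj_of_inj PI'_proj).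
have compat (U : {vspace inflate le_nm M}) : submodule U ->
    L *m ((euler_mx k Q - (euler_mx k Q)^T) *m dim_vec U) = - dim_vec U.
  move=> _; rewrite (dim_vec_inflate le_nm) (mulmxA (_ - _)) -Btilde_euler mulmxA.
  by rewrite -[L *m _]opprK -mulmxN L_compat mulNmx.
rewrite (submod_char_mul Q_acyclic P_proj PM1 f_hom f_neq0 g_hom g_neq0
  i1_hom p1_hom f_exact i2_hom p2_hom g_exact BI0 PA0 compat).
have -> : c = lam L (dim_top P) (- (euler_mx k Q *m dim_mod (inflate le_nm M))).
  by rewrite /c Rtilde_euler -mulmxA -(dim_vec_inflate le_nm).
by [].
Qed.
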